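(* Let $A$ and $B$ be $C^*$-algebras and suppose that ${}_AX_B$ is an $A$--$B$ imprimitivity bimodule. Then $A$ is nuclear if and only if $B$ is nuclear.
   Context: An $A$--$B$ imprimitivity bimodule ${}_AX_B$ is an $A$--$B$ bimodule which is a full left Hilbert $A$-module (inner product ${}_A\langle\cdot,\cdot\rangle$) and a full right Hilbert $B$-module (inner product $\langle\cdot,\cdot\rangle_B$), such that $A$ acts by adjointable operators on $X_B$, $B$ acts by adjointable operators on ${}_AX$, and ${}_A\langle x,y\rangle\cdot z=x\cdot\langle y,z\rangle_B$. A $C^*$-algebra $A$ is nuclear if for every $C^*$-algebra $C$ there is only one $C^*$-norm on the algebraic tensor product $A\odot C$ (equivalently, the maximal and spatial $C^*$-norms on $A\odot C$ coincide). *)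

(* Defs.v *)
(* Complex scalars are R[i] for R : realType. *)
From HB Require Import structures.
From mathcomp Require Import all_boot all_order all_algebra.
From mathcomp Require Import generic_quotient complex.
From mathcomp Require Import boolp classical_sets reals topology normedtype.

Set Implicit Arguments.
Unset Strict Implicit.
Unset Printing Implicit Defensive.

Import Order.TTheory GRing.Theory Num.Theory.
Import numFieldNormedType.Exports.

Local Open Scope quotient_scope.
Local Open Scope classical_set_scope.
Local Open Scope complex_scope.
Local Open Scope ring_scope.

(* The algebraic tensor product of two modules: formal sums of elementary
   tensors, modulo the congruence generated by the usual relations. *)
Section Tensor.
Variables (K : comNzRingType) (A C : lmodType K).

Inductive tensor_cong : seq (A * C) -> seq (A * C) -> Prop :=
| TcRefl s : tensor_cong s s
| TcSym s t : tensor_cong s t -> tensor_cong t s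
| TcTrans s t u : tensor_cong s t -> tensor_cong t u -> tensor_cong s u
| TcCat s s' t t' : tensor_cong s s' -> tensor_cong t t' ->
    tensor_cong (s ++ t) (s' ++ t')
| TcComm s t : tensor_cong (s ++ t) (t ++ s)
| TcZero c : tensor_cong [:: (0, c)] [::]
| TcAddl a a' c : tensor_cong [:: (a + a', c)] [:: (a, c); (a', c)]
| TcAddr a c c' : tensor_cong [:: (a, c + c')] [:: (a, c); (a, c')]
| TcScale z a c : tensor_cong [:: (z *: a, c)] [:: (a, z *: c)].

Definition tensor_eqb (s t : seq (A * C)) : bool := `[< tensor_cong s t >].

Lemma tensor_eqb_refl : reflexive tensor_eqb.
Proof. by move=> s; apply/asboolP; exact: TcRefl. Qed.

Lemma tensor_eqb_sym : symmetric tensor_eqb.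
Proof. by move=> s t; apply/asboolP/asboolP; exact: TcSym. Qed.

Lemma tensor_eqb_trans : transitive tensor_eqb.
Proof.
by move=> t s u /asboolP st /asboolP tu; apply/asboolP; exact: TcTrans tu.
Qed.

Canonical tensor_equiv :=
  EquivRel tensor_eqb tensor_eqb_refl tensor_eqb_sym tensor_eqb_trans.

Definition tensor := {eq_quot tensor_equiv}.
HB.instance Definition _ := Choice.on tensor.
HB.instance Definition _ := EqQuotient.on tensor.

Definition tpure (a : A) (c : C) : tensor := \pi_tensor [:: (a, c)].

Lemma tensor_piE s t : tensor_cong s t -> \pi_tensor s = \pi_tensor t.
Proof.
by move=> st; apply/(@eqmodP _ tensor_equiv)/asboolP.
Qed.

Lemma tensor_repr s : tensor_cong (repr (\pi_tensor s)) s.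
Proof. by apply/asboolP/(@eqmodP _ tensor_equiv); rewrite reprK. Qed.

Definition tzero : tensor := \pi_tensor [::].
Definition tadd (x y : tensor) : tensor := \pi_tensor (repr x ++ repr y).
Definition topp (x : tensor) : tensor :=
  \pi_tensor [seq (- p.1, p.2) | p <- repr x].

Lemma tensor_quotW (P : tensor -> Prop) :
  (forall s, P (\pi_tensor s)) -> forall x, P x.
Proof. by move=> H x; rewrite -[x]reprK; exact: H. Qed.

Lemma tadd_pi s t : tadd (\pi_tensor s) (\pi_tensor t) = \pi_tensor (s ++ t).
Proof. by apply/tensor_piE/TcCat; exact: tensor_repr. Qed.

Lemma taddA : associative tadd.
Proof.
move=> x y z; elim/tensor_quotW: x => s; elim/tensor_quotW: y => t; elim/tensor_quotW: z => u.
by rewrite !tadd_pi catA.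
Qed.

Lemma taddC : commutative tadd.
Proof.
move=> x y; elim/tensor_quotW: x => s; elim/tensor_quotW: y => t.
by rewrite !tadd_pi; apply/tensor_piE/TcComm.
Qed.

Lemma tadd0 : left_id tzero tadd.
Proof. by move=> x; elim/tensor_quotW: x => s; rewrite tadd_pi. Qed.

Lemma taddN : left_inverse tzero topp tadd.
Proof.
move=> x; rewrite -{2}[x]reprK tadd_pi; apply: tensor_piE.
elim: (repr x) => [|[a c] s IH] /=; first exact: TcRefl.
set M := [seq _ | p <- s] in IH *.
rewrite -[(a, c) :: s]cat1s -[(- a, c) :: _]cat1s.
apply: (@TcTrans _ ([:: (- a, c)] ++ ([:: (a, c)] ++ (M ++ s)))).
  apply: TcCat; first exact: TcRefl.
  by rewrite !catA; apply: TcCat (TcRefl _); exact: TcComm.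
apply: (@TcCat [:: (- a, c); (a, c)] [::] (M ++ s) [::]) => //.
apply: (TcTrans (TcSym (TcAddl (- a) a c))).
by rewrite addNr; exact: TcZero.
Qed.

HB.instance Definition _ := GRing.isZmodule.Build tensor taddA taddC tadd0 taddN.

Lemma tensor_piD s t :
  \pi_tensor (s ++ t) = \pi_tensor s + \pi_tensor t.
Proof. by rewrite -[RHS]/(tadd _ _) tadd_pi. Qed.

Lemma tensor_pi_sum s : \pi_tensor s = \sum_(p <- s) tpure p.1 p.2.
Proof.
elim: s => [|[a c] s IH]; first by rewrite big_nil.
by rewrite big_cons -IH -cat1s tensor_piD.
Qed.

Lemma tensor_sum (t : tensor) : t = \sum_(p <- repr t) tpure p.1 p.2.
Proof. by rewrite -tensor_pi_sum reprK. Qed.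

Lemma tpureDl a a' c : tpure (a + a') c = tpure a c + tpure a' c.
Proof. by rewrite -tensor_piD; apply/tensor_piE/TcAddl. Qed.

Lemma tpureDr a c c' : tpure a (c + c') = tpure a c + tpure a c'.
Proof. by rewrite -tensor_piD; apply/tensor_piE/TcAddr. Qed.

Lemma tpureZ z a c : tpure (z *: a) c = tpure a (z *: c).
Proof. exact/tensor_piE/TcScale. Qed.

Section Lift.
Variable V : zmodType.

(* Biadditive balanced maps, rather than bilinear ones, so that
   conjugate-linear maps lift to the tensor product as well. *)
Definition balanced (f : A -> C -> V) :=
  [/\ forall a a' c, f (a + a') c = f a c + f a' c,
      forall a c c', f a (c + c') = f a c + f a c'
    & forall z a c, f (z *: a) c = f a (z *: c)].

Definition tlift (f : A -> C -> V) (t : tensor) : V :=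
  \sum_(p <- repr t) f p.1 p.2.

Variables (f : A -> C -> V) (fP : balanced f).

Lemma tlift_pi s : tlift f (\pi_tensor s) = \sum_(p <- s) f p.1 p.2.
Proof.
have [fDl fDr fZ] := fP.
have f0 c : f 0 c = 0 by apply: (addrI (f 0 c)); rewrite -fDl !addr0.
have key s1 s2 : tensor_cong s1 s2 ->
    \sum_(p <- s1) f p.1 p.2 = \sum_(p <- s2) f p.1 p.2.
  elim => //=.
  - by move=> ? ? ? _ -> _ ->.
  - by move=> ? ? ? ? _ e1 _ e2; rewrite !big_cat /= e1 e2.
  - by move=> ? ?; rewrite !big_cat /= addrC.
  - by move=> c; rewrite big_seq1 big_nil f0.
  - by move=> a a' c; rewrite !big_cons !big_nil !addr0 fDl.
  - by move=> a c c'; rewrite !big_cons !big_nil !addr0 fDr.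
  - by move=> z a c; rewrite !big_seq1 fZ.
exact/key/tensor_repr.
Qed.

Lemma tlift_pure a c : tlift f (tpure a c) = f a c.
Proof. by rewrite tlift_pi big_seq1. Qed.

Lemma tliftD x y : tlift f (x + y) = tlift f x + tlift f y.
Proof.
elim/tensor_quotW: x => s; elim/tensor_quotW: y => t.
by rewrite -tensor_piD !tlift_pi big_cat.
Qed.

End Lift.

Lemma tensor_ind (P : tensor -> Prop) :
  P 0 -> (forall x y, P x -> P y -> P (x + y)) ->
  (forall a c, P (tpure a c)) -> forall t, P t.
Proof. by move=> P0 PD Pp t; rewrite [t]tensor_sum; apply: big_ind. Qed.

Lemma tlift0 (V : zmodType) (f : A -> C -> V) : balanced f -> tlift f 0 = 0.
Proof. by move=> fP; rewrite -[0]/(\pi_tensor [::]) tlift_pi // big_nil. Qed.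

Definition tscale (z : K) : tensor -> tensor :=
  tlift (fun a c => tpure (z *: a) c).

Lemma tscale_balanced z : balanced (fun a c => tpure (z *: a) c).
Proof.
split=> [a a' c|a c c'|w a c].
- by rewrite scalerDr tpureDl.
- by rewrite tpureDr.
- by rewrite scalerA mulrC -scalerA tpureZ.
Qed.

Lemma tscale_pure z a c : tscale z (tpure a c) = tpure (z *: a) c.
Proof. exact: (tlift_pure (tscale_balanced z)). Qed.

Lemma tscaleDr : right_distributive tscale +%R.
Proof. by move=> z x y; exact: (tliftD (tscale_balanced z)). Qed.

Lemma tscale0 z : tscale z 0 = 0.
Proof. exact: (tlift0 (tscale_balanced z)). Qed.

Lemma tscaleA z w t : tscale z (tscale w t) = tscale (z * w) t.
Proof.
elim/tensor_ind: t => [|x y ex ey|a c]; first by rewrite !tscale0.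
  by rewrite !tscaleDr ex ey.
by rewrite !tscale_pure scalerA.
Qed.

Lemma tscale1 : left_id 1 tscale.
Proof.
move=> t; elim/tensor_ind: t => [|x y ex ey|a c]; first by rewrite tscale0.
  by rewrite !tscaleDr ex ey.
by rewrite tscale_pure scale1r.
Qed.

Lemma tscaleDl t : {morph tscale^~ t : z w / z + w}.
Proof.
move=> z w /=; elim/tensor_ind: t => [|x y ex ey|a c].
- by rewrite !tscale0 addr0.
- by rewrite !tscaleDr ex ey addrACA.
- by rewrite !tscale_pure scalerDl tpureDl.
Qed.

HB.instance Definition _ :=
  GRing.Zmodule_isLmodule.Build K tensor tscaleA tscale1 tscaleDr tscaleDl.

Lemma tpureZl z a c : tpure (z *: a) c = z *: tpure a c.
Proof. by rewrite -[RHS]/(tscale _ _) tscale_pure. Qed.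

Lemma tpureZr z a c : tpure a (z *: c) = z *: tpure a c.
Proof. by rewrite -tpureZ tpureZl. Qed.

End Tensor.

(* Not necessarily unital, so the product is not a ring structure of MathComp. *)
HB.mixin Record Lmodule_isStarAlgebra (R : realType) A
    of GRing.Lmodule R[i] A := {
  smul : A -> A -> A;
  star : A -> A;
  smulA : associative smul;
  smulDl : left_distributive smul +%R;
  smulDr : right_distributive smul +%R;
  smulZl : forall (z : R[i]) x y, smul (z *: x) y = z *: smul x y;
  smulZr : forall (z : R[i]) x y, smul x (z *: y) = z *: smul x y;
  starK : involutive star;
  starD : {morph star : x y / x + y};
  starZ : forall (z : R[i]) x, star (z *: x) = z^* *: star x;
  starM : forall x y, star (smul x y) = smul (star y) (star x)
}.

#[short(type="starAlgType")]
HB.structure Definition StarAlgebra (R : realType) :=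
  {A of GRing.Lmodule R[i] A & Lmodule_isStarAlgebra R A}.

Notation "x ** y" := (smul x y) (at level 40, left associativity) : ring_scope.

(* As for the norms of MathComp-Analysis over the field R[i], the values are in
   R[i]; there 0 <= z means that z is a nonnegative real. *)
Record cstar_norm (R : realType) (A : starAlgType R) (p : A -> R[i]) : Prop := {
  cstar_norm_ge0 : forall x, 0 <= p x;
  cstar_norm_eq0 : forall x, p x = 0 -> x = 0;
  cstar_normD : forall x y, p (x + y) <= p x + p y;
  cstar_normZ : forall (z : R[i]) x, p (z *: x) = `|z| * p x;
  cstar_normM : forall x y, p (x ** y) <= p x * p y;
  cstar_normE : forall x, p (star x ** x) = p x ^+ 2
}.

HB.mixin Record isCStarAlgebra (R : realType) A
    of StarAlgebra R A & CompleteNormedModule R[i] A := {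
  norm_is_cstar : cstar_norm (fun x : A => `|x| : R[i])
}.

#[short(type="cstarAlgType")]
HB.structure Definition CStarAlgebra (R : realType) :=
  {A of StarAlgebra R A & CompleteNormedModule R[i] A & isCStarAlgebra R A}.

Section TensorStar.
Variables (R : realType) (A C : starAlgType R).
Local Notation T := (tensor A C).

Definition tmul_pure (a : A) (c : C) : T -> T :=
  tlift (fun a' c' => tpure (a ** a') (c ** c')).
Definition tmul (x y : T) : T := tlift (fun a c => tmul_pure a c y) x.
Definition tstar : T -> T := tlift (fun a c => tpure (star a) (star c)).

Lemma tmul_pure_balanced a c :
  balanced (fun a' c' => tpure (a ** a') (c ** c') : T).
Proof.
split=> [a1 a2 c1|a1 c1 c2|z a1 c1].
- by rewrite smulDr tpureDl.
- by rewrite smulDr tpureDr.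
- by rewrite !smulZr tpureZ.
Qed.

Lemma tmul_balanced y : balanced (fun a c => tmul_pure a c y).
Proof.
have B := tmul_pure_balanced.
split=> [a1 a2 c1|a1 c1 c2|z a1 c1]; rewrite /tmul_pure;
  elim/tensor_ind: y => [|u v eu ev|a c];
  rewrite ?(tlift0 (B _ _)) ?addr0 // ?(tliftD (B _ _)) ?eu ?ev //.
- by rewrite addrACA.
- by rewrite !(tlift_pure (B _ _)) smulDl tpureDl.
- by rewrite addrACA.
- by rewrite !(tlift_pure (B _ _)) smulDl tpureDr.
- by rewrite !(tlift_pure (B _ _)) !smulZl tpureZ.
Qed.

Lemma tstar_balanced : balanced (fun a c => tpure (star a) (star c) : T).
Proof.
split=> [a1 a2 c1|a1 c1 c2|z a1 c1].
- by rewrite starD tpureDl.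
- by rewrite starD tpureDr.
- by rewrite !starZ tpureZ.
Qed.

Lemma tmulE a c a' c' :
  tmul (tpure a c) (tpure a' c') = tpure (a ** a') (c ** c').
Proof.
by rewrite /tmul (tlift_pure (tmul_balanced _)) /tmul_pure
  (tlift_pure (tmul_pure_balanced a c)).
Qed.

Lemma tmulDl : left_distributive tmul +%R.
Proof. by move=> x y z; exact: (tliftD (tmul_balanced z)). Qed.

Lemma tmul0l y : tmul 0 y = 0.
Proof. exact: (tlift0 (tmul_balanced y)). Qed.

Lemma tmul0r x : tmul x 0 = 0.
Proof.
elim/tensor_ind: x => [|x y ex ey|a c]; first by rewrite tmul0l.
  by rewrite tmulDl ex ey addr0.
by rewrite /tmul (tlift_pure (tmul_balanced _)) /tmul_pure
  (tlift0 (tmul_pure_balanced a c)).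
Qed.

Lemma tmulDr : right_distributive tmul +%R.
Proof.
move=> x y z; elim/tensor_ind: x => [|u v eu ev|a c].
- by rewrite !tmul0l addr0.
- by rewrite !tmulDl eu ev addrACA.
- by rewrite /tmul !(tlift_pure (tmul_balanced _)) /tmul_pure
    (tliftD (tmul_pure_balanced a c)).
Qed.

Lemma tmulA : associative tmul.
Proof.
move=> x y z; elim/tensor_ind: x => [|u v eu ev|a c].
- by rewrite !tmul0l.
- by rewrite !tmulDl eu ev.
elim/tensor_ind: y => [|u v eu ev|a' c'].
- by rewrite !(tmul0l, tmul0r).
- by rewrite !(tmulDl, tmulDr) eu ev.
elim/tensor_ind: z => [|u v eu ev|a'' c''].
- by rewrite !tmul0r.
- by rewrite !tmulDr eu ev.
by rewrite !tmulE !smulA.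
Qed.

Lemma tmulZl (z : R[i]) x y : tmul (z *: x) y = z *: tmul x y.
Proof.
elim/tensor_ind: x => [|u v eu ev|a c].
- by rewrite scaler0 tmul0l scaler0.
- by rewrite scalerDr !tmulDl eu ev scalerDr.
elim/tensor_ind: y => [|u v eu ev|a' c'].
- by rewrite !tmul0r scaler0.
- by rewrite !tmulDr eu ev scalerDr.
by rewrite -tpureZl !tmulE smulZl tpureZl.
Qed.

Lemma tmulZr (z : R[i]) x y : tmul x (z *: y) = z *: tmul x y.
Proof.
elim/tensor_ind: x => [|u v eu ev|a c].
- by rewrite !tmul0l scaler0.
- by rewrite !tmulDl eu ev scalerDr.
elim/tensor_ind: y => [|u v eu ev|a' c'].
- by rewrite scaler0 tmul0r scaler0.
- by rewrite scalerDr !tmulDr eu ev scalerDr.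
by rewrite -tpureZl !tmulE smulZr tpureZl.
Qed.

Lemma tstarE a c : tstar (tpure a c) = tpure (star a) (star c).
Proof. exact: (tlift_pure tstar_balanced). Qed.

Lemma tstarD : {morph tstar : x y / x + y}.
Proof. by move=> x y; exact: (tliftD tstar_balanced). Qed.

Lemma tstar0 : tstar 0 = 0.
Proof. exact: (tlift0 tstar_balanced). Qed.

Lemma tstarK : involutive tstar.
Proof.
move=> t; elim/tensor_ind: t => [|u v eu ev|a c]; first by rewrite !tstar0.
  by rewrite !tstarD eu ev.
by rewrite !tstarE !starK.
Qed.

Lemma tstarZ (z : R[i]) x : tstar (z *: x) = z^* *: tstar x.
Proof.
elim/tensor_ind: x => [|u v eu ev|a c].
- by rewrite scaler0 tstar0 scaler0.
- by rewrite scalerDr !tstarD eu ev scalerDr.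
- by rewrite -tpureZl !tstarE starZ tpureZl.
Qed.

Lemma tstarM x y : tstar (tmul x y) = tmul (tstar y) (tstar x).
Proof.
elim/tensor_ind: x => [|u v eu ev|a c].
- by rewrite tmul0l tstar0 tmul0r.
- by rewrite tmulDl !tstarD eu ev tmulDr.
elim/tensor_ind: y => [|u v eu ev|a' c'].
- by rewrite tmul0r tstar0 tmul0l.
- by rewrite tmulDr !tstarD eu ev tmulDl.
by rewrite tmulE !tstarE tmulE !starM.
Qed.

HB.instance Definition _ := Lmodule_isStarAlgebra.Build R T
  tmulA tmulDl tmulDr tmulZl tmulZr tstarK tstarD tstarZ tstarM.

End TensorStar.

Definition nuclear (R : realType) (A : cstarAlgType R) : Prop :=
  forall C : cstarAlgType R, exists! p : tensor A C -> R[i], cstar_norm p.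

Definition cstar_pos (R : realType) (A : cstarAlgType R) (a : A) : Prop :=
  exists b : A, a = star b ** b.

Definition linear_span (K : nzRingType) (V : lmodType K) (S : set V) : set V :=
  [set v | exists2 s : seq (K * V),
    (forall p, p \in s -> S p.2) & v = \sum_(p <- s) p.1 *: p.2].

(* Sequential completeness of V for the distance n (x - y). *)
Definition complete_for (R : realType) (V : lmodType R[i]) (n : V -> R[i]) :=
  forall u : nat -> V,
    (forall e : R[i], 0 < e -> exists N, forall j k,
       (N <= j)%N -> (N <= k)%N -> n (u j - u k) < e) ->
    exists l : V, forall e : R[i], 0 < e -> exists N, forall j,
       (N <= j)%N -> n (u j - l) < e.

(* The norm of a Hilbert module with inner product ip. *)
Definition ip_norm (R : realType) (A : cstarAlgType R) (X : lmodType R[i])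
  (ip : X -> X -> A) (x : X) : R[i] := sqrtC `|ip x x|.

Record left_hilbert_module (R : realType) (A : cstarAlgType R)
    (X : lmodType R[i]) (act : A -> X -> X) (ip : X -> X -> A) : Prop := {
  lact_A : forall a b x, act (a ** b) x = act a (act b x);
  lactDl : forall a b x, act (a + b) x = act a x + act b x;
  lactDr : forall a x y, act a (x + y) = act a x + act a y;
  lactZl : forall (z : R[i]) a x, act (z *: a) x = z *: act a x;
  lactZr : forall (z : R[i]) a x, act a (z *: x) = z *: act a x;
  lipDl : forall x y w, ip (x + y) w = ip x w + ip y w;
  lipZl : forall (z : R[i]) x y, ip (z *: x) y = z *: ip x y;
  lip_act : forall a x y, ip (act a x) y = a ** ip x y;
  lip_star : forall x y, star (ip x y) = ip y x;
  lip_pos : forall x, cstar_pos (ip x x);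
  lip_eq0 : forall x, ip x x = 0 -> x = 0;
  lip_complete : complete_for (ip_norm ip)
}.

Record right_hilbert_module (R : realType) (B : cstarAlgType R)
    (X : lmodType R[i]) (act : X -> B -> X) (ip : X -> X -> B) : Prop := {
  ract_A : forall x a b, act x (a ** b) = act (act x a) b;
  ractDl : forall x y b, act (x + y) b = act x b + act y b;
  ractDr : forall x a b, act x (a + b) = act x a + act x b;
  ractZl : forall (z : R[i]) x b, act (z *: x) b = z *: act x b;
  ractZr : forall (z : R[i]) x b, act x (z *: b) = z *: act x b;
  ripDr : forall w x y, ip w (x + y) = ip w x + ip w y;
  ripZr : forall (z : R[i]) x y, ip x (z *: y) = z *: ip x y;
  rip_act : forall x y b, ip x (act y b) = ip x y ** b;
  rip_star : forall x y, star (ip x y) = ip y x;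
  rip_pos : forall x, cstar_pos (ip x x);
  rip_eq0 : forall x, ip x x = 0 -> x = 0;
  rip_complete : complete_for (ip_norm ip)
}.

Definition full_ip (R : realType) (A : cstarAlgType R) (X : Type)
    (ip : X -> X -> A) : Prop :=
  dense (linear_span [set a : A | exists x y, a = ip x y]).

Definition adjointable (X Y : Type) (ip : X -> X -> Y) (f : X -> X) : Prop :=
  exists g : X -> X, forall x y, ip (f x) y = ip x (g y).

(* That the adjoints of the actions of a and b are those of star a and star b
   follows from ib_compat and fullness. *)
Record imprimitivity_bimodule (R : realType) (A B : cstarAlgType R) := {
  ib_carrier :> lmodType R[i];
  ib_lact : A -> ib_carrier -> ib_carrier;
  ib_ract : ib_carrier -> B -> ib_carrier;
  ib_lip : ib_carrier -> ib_carrier -> A;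
  ib_rip : ib_carrier -> ib_carrier -> B;
  ib_bimodule : forall a x b,
    ib_ract (ib_lact a x) b = ib_lact a (ib_ract x b);
  ib_left : left_hilbert_module ib_lact ib_lip;
  ib_right : right_hilbert_module ib_ract ib_rip;
  ib_left_full : full_ip ib_lip;
  ib_right_full : full_ip ib_rip;
  ib_lact_adj : forall a, adjointable ib_rip (ib_lact a);
  ib_ract_adj : forall b, adjointable ib_lip (fun x => ib_ract x b);
  ib_compat : forall x y z,
    ib_lact (ib_lip x y) z = ib_ract x (ib_rip y z)
}.

(* Main.v *)
(* The idea is to transfer C*-norms between A (x) C and B (x) C through E = X (x) C, which
   carries inner products l and r with values in the two tensor products and
   l(x,y) z = x r(y,z).  A C*-norm q on B (x) C gives the norm n(x) = q(r(x,x))^(1/2) on E,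
   and the operator norm p of the left action on (E, n) is a C*-norm on A (x) C with
   p(l(x,x)) = q(r(x,x)).  Hence p determines n, and n determines q: for self-adjoint s,
   approximate s^2 by sums of elements r(x,y) and compare the growth of the powers of s.
   Applied to X and to its conjugate bimodule, this transfers both the existence and the
   uniqueness of the C*-norm.

   Everything rests on the monotonicity of q on the elements r(x,x), that is, on their
   positivity in the completion of B (x) C.  No completion and no spectral theory is used:
   a self-adjoint h counts as positive when |t - h| <= t for some t >= 0, square roots are
   replaced with polynomials, and the spectral radius with the identity |h^n| = |h|^n. *)

(* Nuclearity speaks of every C*-norm and also asks for one to exist, so an arbitrary norm q must be
   transported, and q is known on the algebraic tensor product only. The obstacle lies there: for x
   = sum_i x_i (x) c_i the element r(x,x) = sum_ij <x_i,x_j> (x) c_i^* c_j is not visibly of the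
   form s^*s in B (x) C. The classical remedy is a square root of the Gram matrix in M_n(B). Its
   place is taken by the operator h = t sum_i l(x_i,x_i) with a small t > 0: <y, l(u,u) y> = <u,y>^*
   <u,y> makes <y, h y> a sum of elements s^*s, and (1 - h)^n x_i tends to 0, so that r(x,x) is the
   limit of <x, (1 - (1 - h)^n) x>, where 1 - (1 - h)^n has a factor h. Crude constants do no harm:
   wherever a sharp inequality a <= b is wanted, it is enough to bound a^n by b^n up to a factor
   affine in n. *)
From HB Require Import structures.
Require Import Defs.
From mathcomp Require Import all_boot all_order all_algebra.
From mathcomp Require Import complex ring lra.
From mathcomp Require Import boolp classical_sets reals topology normedtype.

Set Implicit Arguments.
Unset Strict Implicit.
Unset Printing Implicit Defensive.

Import Order.TTheory GRing.Theory Num.Theory.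
Import numFieldNormedType.Exports.

Local Open Scope complex_scope.
Local Open Scope ring_scope.

(* Reflexive decision procedure for identities in an abelian group. *)
Inductive zexpr :=
  | ZVar of nat | ZAdd of zexpr & zexpr | ZOpp of zexpr | ZMuln of zexpr & nat | Z0.

Section Zmod.
Variable V : zmodType.

Fixpoint zeval (env : seq V) (a : zexpr) : V :=
  match a with
  | ZVar i => env`_i
  | ZAdd a b => zeval env a + zeval env b
  | ZOpp a => - zeval env a
  | ZMuln a n => zeval env a *+ n
  | Z0 => 0
  end.

Fixpoint zcoef (a : zexpr) (i : nat) : int :=
  match a with
  | ZVar j => (i == j)%:R
  | ZAdd a b => zcoef a i + zcoef b i
  | ZOpp a => - zcoef a i
  | ZMuln a n => zcoef a i *+ n
  | Z0 => 0
  end.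

Lemma zevalE env a : zeval env a = \sum_(i < size env) env`_i *~ zcoef a i.
Proof.
elim: a => [j|a IHa b IHb|a IHa|a IHa n|] /=.
- have [jn|jn] := ltnP j (size env).
    rewrite (bigD1 (Ordinal jn)) //= eqxx big1 ?addr0 // => i.
    by rewrite -val_eqE /= => /negPf->.
  rewrite nth_default // big1 // => i _.
  by rewrite [_ == j]ltn_eqF // (leq_trans _ jn).
- by rewrite IHa IHb -big_split; apply: eq_bigr => i _; rewrite mulrzDr.
- by rewrite IHa -sumrN; apply: eq_bigr => i _; rewrite mulrNz.
- by rewrite IHa -sumrMnl; apply: eq_bigr => i _; rewrite -mulr_natr mulrzA natz -pmulrn.
- by rewrite big1.
Qed.

Lemma zmodP env a b :
  all (fun i => zcoef a i == zcoef b i) (iota 0 (size env)) ->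
  zeval env a = zeval env b.
Proof.
move=> /allP H; rewrite !zevalE; apply: eq_bigr => i _.
by rewrite (eqP (H i _)) // mem_iota ltn_ord.
Qed.

End Zmod.

(** Atoms are compared by unification, not by syntax. The matches on [constr:(Set)] allow the tactic
    [unify] to run while a term is being computed. *)
Ltac zmod_eq x y :=
  match constr:(Set) with
  | _ => let _ := match constr:(Set) with _ => unify x y end in constr:(true)
  | _ => constr:(false)
  end.
Ltac zmod_index x env :=
  lazymatch env with
  | ?y :: ?env' =>
    lazymatch zmod_eq x y with
    | true => constr:(0%N)
    | false => let n := zmod_index x env' in constr:(n.+1)
    end
  end.
Ltac zmod_mem x env :=
  lazymatch env with
  | nil => constr:(false)
  | ?y :: ?env' =>
    lazymatch zmod_eq x y with
    | true => constr:(true)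
    | false => zmod_mem x env'
    end
  end.
Ltac zmod_env t env :=
  lazymatch t with
  | ?a + ?b => let env := zmod_env a env in zmod_env b env
  | - ?a => zmod_env a env
  | ?a *+ _ => zmod_env a env
  | 0 => env
  | _ => lazymatch zmod_mem t env with
         | true => env
         | false => constr:(t :: env)
         end
  end.
Ltac zmod_reify t env :=
  lazymatch t with
  | ?a + ?b => let a := zmod_reify a env in let b := zmod_reify b env in
               constr:(ZAdd a b)
  | - ?a => let a := zmod_reify a env in constr:(ZOpp a)
  | ?a *+ ?n => let a := zmod_reify a env in constr:(ZMuln a n)
  | 0 => constr:(Z0)
  | _ => let n := zmod_index t env in constr:(ZVar n)
  end.
Ltac zmod :=
  lazymatch goal with
  | |- @eq ?T ?a ?b =>
    let env := zmod_env a (@nil T) in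
    let env := zmod_env b env in
    let a' := zmod_reify a env in
    let b' := zmod_reify b env in
    exact: (@zmodP _ env a' b' isT)
  end.

(** * Growth estimates *)

Section RealLemmas.
Variable R : realType.
Implicit Types a b C D x : R.

Lemma bernoulli x n : 0 <= x -> 1 + n%:R * x <= (1 + x) ^+ n.
Proof.
move=> x0; elim: n => [|n IH]; first by rewrite mul0r addr0 expr0.
have n0 : (0 : R) <= n%:R by [].
have := ler_wpM2l (ltac:(lra) : 0 <= 1 + x) IH.
rewrite exprS -natr1; nra.
Qed.

Lemma natr_unbounded x C : 0 < x -> exists n : nat, C < n%:R * x.
Proof.
move=> x0; exists (Num.bound `|C / x|); rewrite -ltr_pdivrMr //.
exact: le_lt_trans (ler_norm _) (archi_boundP (normr_ge0 _)).
Qed.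

Lemma le_eps a b : (forall e, 0 < e -> a <= b + e) -> a <= b.
Proof. by move=> H; apply/ler_addgt0Pr => e /H. Qed.

Lemma le_epsM a b K : 0 <= K -> (forall e, 0 < e -> a <= b + K * e) -> a <= b.
Proof.
move=> K0 H; apply: le_eps => e e0.
have K1 : 0 < K + 1 by lra.
have /H : 0 < e / (K + 1) by rewrite divr_gt0.
move/le_trans; apply; rewrite lerD2l mulrCA ler_piMr ?(ltW e0) // ler_pdivrMr //; lra.
Qed.

Lemma le_epsM1 a b K : 0 <= K ->
  (forall e, 0 < e -> e <= 1 -> a <= b + K * e) -> a <= b.
Proof.
move=> K0 H; apply: (le_epsM K0) => e e0.
have m0 : 0 < Num.min e 1 by rewrite lt_min e0 ltr01.
rewrite (le_trans (H _ m0 _)) ?ge_min ?lexx ?orbT // lerD2l ler_wpM2l //.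
by rewrite ge_min lexx.
Qed.

(* Exponential growth of a/b > 1 beats any affine function. *)
Lemma pow_growth a b C D k : 0 <= a -> 0 <= b ->
  (forall n, a ^+ (n + k) <= (C + D * n%:R) * b ^+ n) -> a <= b.
Proof.
move=> a0 b0 H; rewrite leNgt; apply/negP => ba.
have {}a0 : 0 < a by exact: le_lt_trans ba.
have [b00|bn0] := eqVneq b 0.
  by have := H 1%N; rewrite b00 expr1 mulr0 leNgt exprn_gt0.
have {}b0 : 0 < b by rewrite lt_def bn0 b0.
pose x := a / b - 1.
have x0 : 0 < x by rewrite subr_gt0 ltr_pdivlMr // mul1r.
have ab : a = b * (1 + x) by rewrite /x addrC subrK mulrCA divff ?mulr1.
have [m Hm] := natr_unbounded (`|C| + 2 * `|D| + 1)
  (mulr_gt0 (exprn_gt0 k a0) (exprn_gt0 2 x0)).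
have m0 : 1 <= m%:R :> R.
  rewrite ler1n lt0n; apply/eqP => m0; move: Hm; rewrite m0 mul0r.
  by have := normr_ge0 C; have := normr_ge0 D; lra.
(* At exponent 2m the square of Bernoulli's inequality gives a lower bound quadratic in m, against a
   right side linear in m; [m] was chosen for this comparison. *)
have /(_ m.*2) := H; rewrite exprD {1}ab exprMn -mulrA mulrC.
rewrite ler_pM2r ?exprn_gt0 // leNgt => /negP; apply.
have Bm := bernoulli m (ltW x0).
have : (m%:R * x) ^+ 2 <= (1 + x) ^+ m.*2.
  rewrite -muln2 exprM lerXn2r ?nnegrE //; last by lra.
  - by rewrite mulr_ge0 // ltW.
  - by rewrite exprn_ge0 // addr_ge0 // ltW.
rewrite -(ler_pM2r (exprn_gt0 k a0)); apply: lt_le_trans.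
have := ler_norm C; have := ler_norm D; have := normr_ge0 C; have := normr_ge0 D.
rewrite -mul2n natrM; move: (`|C|) (`|D|) (a ^+ k) Hm => c d A Hm d0 c0 dD cC.
have : (c + 2 * d + 1) * m%:R < m%:R * (A * x ^+ 2) * m%:R.
  by rewrite ltr_pM2r //; lra.
nra.
Qed.

(* The recursion of the binomial series of 1 - sqrt (1 - x) at x = 1; it dominates
   the corresponding recursion in a C*-algebra. *)
Fixpoint rho (n : nat) : R := if n is n'.+1 then (1 + rho n' ^+ 2) / 2 else 0.

Lemma rho_ge0 n : 0 <= rho n.
Proof. by case: n => //= n; rewrite divr_ge0 // addr_ge0 // sqr_ge0. Qed.

Lemma rho_le1 n : rho n <= 1.
Proof. elim: n => /= [|n IH]; first exact: ler01. have := rho_ge0 n; nra. Qed.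

Lemma rhoS_sub n : rho n.+1 - rho n = (1 - rho n) ^+ 2 / 2.
Proof. by rewrite /=; field. Qed.

Lemma rho_le m n : (m <= n)%N -> rho m <= rho n.
Proof.
move=> mn; apply: (homo_leq (@lexx _ _) le_trans) mn => i.
by rewrite -subr_ge0 rhoS_sub divr_ge0 // sqr_ge0.
Qed.

(** A gap that stayed above [e] would add more than e^2/2 to [rho] at every step, against
    [rho_le1]. *)
Lemma rho_cvg1 e : 0 < e -> exists n, 1 - rho n <= e.
Proof.
move=> e0; apply/not_existsP => H.
have {}H n : e < 1 - rho n by rewrite ltNge; apply/negP/H.
have G n : n%:R * (e ^+ 2 / 2) <= rho n.
  elim: n => [|n IH]; first by rewrite mul0r.
  rewrite -natr1 mulrDl mul1r -(subrK (rho n) (rho n.+1)) addrC lerD //.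
  have := H n; rewrite rhoS_sub; nra.
have [n] := natr_unbounded 1 (ltac:(nra) : 0 < e ^+ 2 / 2).
by rewrite ltNge (le_trans (G n)) // rho_le1.
Qed.

End RealLemmas.

Lemma conjCr (R : realType) (t : R) : (t%:C)^* = t%:C :> R[i].
Proof. exact: conjc_real. Qed.

Lemma half_dbl (R : realType) (V : lmodType R[i]) (x : V) :
  (2^-1 : R)%:C *: (x + x) = x.
Proof.
rewrite -{1 2}(scale1r x) -scalerDl scalerA -(rmorph1 (real_complex R)) -rmorphD -rmorphM.
have -> : 2^-1 * (1 + 1) = 1 :> R by lra.
by rewrite rmorph1 scale1r.
Qed.

(** * Star-algebras and C*-seminorms *)

Section StarAlgebraTheory.
Variables (R : realType) (D : starAlgType R).
Implicit Types x y z : D.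

Lemma smul0l x : 0 ** x = 0.
Proof. by have := smulZl 0 0 x; rewrite !scale0r. Qed.
Lemma smul0r x : x ** 0 = 0.
Proof. by have := smulZr 0 x 0; rewrite !scale0r. Qed.
Lemma smulNl x y : (- x) ** y = - (x ** y).
Proof. by rewrite -scaleN1r smulZl scaleN1r. Qed.
Lemma smulNr x y : x ** (- y) = - (x ** y).
Proof. by rewrite -scaleN1r smulZr scaleN1r. Qed.
Lemma smulBl x y z : (x - y) ** z = x ** z - y ** z.
Proof. by rewrite smulDl smulNl. Qed.
Lemma smulBr x y z : x ** (y - z) = x ** y - x ** z.
Proof. by rewrite smulDr smulNr. Qed.
Lemma star0 : star 0 = 0 :> D.
Proof. by have := starZ 0 (0 : D); rewrite !scale0r rmorph0 scale0r. Qed.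
Lemma starN x : star (- x) = - star x.
Proof. by rewrite -scaleN1r starZ rmorphN1 scaleN1r. Qed.
Lemma starB x y : star (x - y) = star x - star y.
Proof. by rewrite starD starN. Qed.
Lemma starZr (t : R) x : star (t%:C *: x) = t%:C *: star x.
Proof. by rewrite starZ conjCr. Qed.
Lemma star_sum I (s : seq I) (F : I -> D) :
  star (\sum_(i <- s) F i) = \sum_(i <- s) star (F i).
Proof. exact: (big_morph _ (@starD _ D) star0). Qed.
Lemma smul_suml I (s : seq I) (F : I -> D) x :
  (\sum_(i <- s) F i) ** x = \sum_(i <- s) F i ** x.
Proof. exact: (big_morph (fun u => u ** x) (fun u v => smulDl u v x) (smul0l x)). Qed.

(* [spow x n] is the power of exponent n.+1. *)
Definition spow x n := iter n (smul x) x.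

Lemma spowSr x n : spow x n ** x = spow x n.+1.
Proof. by elim: n => //= n IH; rewrite -smulA IH. Qed.
Lemma spowD x m n : spow x m ** spow x n = spow x (m + n).+1.
Proof. by elim: m => //= m IH; rewrite -smulA IH. Qed.
Lemma star_spow x n : star x = x -> star (spow x n) = spow x n.
Proof. by move=> sx; elim: n => //= n IH; rewrite starM IH sx spowSr. Qed.

End StarAlgebraTheory.

Notation normc := ComplexField.Normc.normc.

Record cstar_semi (R : realType) (D : starAlgType R) (N : D -> R) : Prop := {
  semi_ge0 : forall x, 0 <= N x;
  semiD : forall x y, N (x + y) <= N x + N y;
  semiZ : forall (z : R[i]) x, N (z *: x) = normc z * N x;
  semiM : forall x y, N (x ** y) <= N x * N y;
  semiE : forall x, N (star x ** x) = N x ^+ 2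
}.

Section Seminorm.
Variables (R : realType) (V : lmodType R[i]) (n : V -> R).
Hypothesis nD : forall x y, n (x + y) <= n x + n y.
Hypothesis nZ : forall (z : R[i]) x, n (z *: x) = normc z * n x.

Lemma normc_real (t : R) : normc t%:C = `|t|.
Proof. by rewrite /normc /= expr0n /= addr0 sqrtr_sqr. Qed.
Lemma normc_i : normc 'i%C = 1 :> R.
Proof. by rewrite /normc /= expr0n /= add0r expr1n sqrtr1. Qed.
Lemma snormr (t : R) x : n (t%:C *: x) = `|t| * n x.
Proof. by rewrite nZ normc_real. Qed.
Lemma snorm0 : n 0 = 0.
Proof. by rewrite -(scale0r 0) nZ ComplexField.Normc.normc0 mul0r. Qed.
Lemma snormN x : n (- x) = n x.
Proof.
have -> : - x = (- 1 : R)%:C *: x by rewrite rmorphN1 scaleN1r.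
by rewrite snormr normrN1 mul1r.
Qed.
Lemma snormB x y : n (x - y) <= n x + n y.
Proof. by rewrite -(snormN y) nD. Qed.
Lemma snormC x y : n (x - y) = n (y - x).
Proof. by rewrite -snormN opprB. Qed.
Lemma snorm_le_sub x y : n x <= n y + n (x - y).
Proof. by rewrite -{1}(subrK y x) addrC nD. Qed.
Lemma snorm_sum I (s : seq I) (F : I -> V) :
  n (\sum_(i <- s) F i) <= \sum_(i <- s) n (F i).
Proof.
elim: s => [|i s IH]; first by rewrite !big_nil snorm0.
by rewrite !big_cons (le_trans (nD _ _)) // lerD2l.
Qed.
End Seminorm.

Section SemiTheory.
Variables (R : realType) (D : starAlgType R) (N : D -> R).
Hypothesis HN : cstar_semi N.
Implicit Types x y : D.

Lemma semi_star x : N (star x) = N x.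
Proof.
suff H y : N y <= N (star y) by apply/eqP; rewrite eq_le H -{2}(starK x) H.
have := semiM HN (star y) y; rewrite (semiE HN) expr2.
have := semi_ge0 HN y; rewrite le_eqVlt => /predU1P[<-|y0]; first by rewrite (semi_ge0 HN).
by rewrite ler_pM2r.
Qed.

Lemma semi_sq x : star x = x -> N (x ** x) = N x ^+ 2.
Proof. by move=> sx; rewrite -(semiE HN) sx. Qed.

Lemma semi_spow_le x n : N (spow x n) <= N x ^+ n.+1.
Proof.
elim: n => [|n IH]; first by rewrite expr1.
by rewrite exprS /= (le_trans (semiM HN _ _)) // ler_wpM2l // (semi_ge0 HN).
Qed.

(** Repeated squaring gives equality at the exponents 2^k. A smaller exponent inherits it:
    N(x)^(2^k) is at most [N (spow x n)] times a power of [N x], which cancels. *)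
Lemma semi_spow x n : star x = x -> N (spow x n) = N x ^+ n.+1.
Proof.
move=> sx; have N0 := semi_ge0 HN.
have pow2 k : N (spow x (2 ^ k).-1) = N x ^+ (2 ^ k).
  elim: k => [|k IH]; first by rewrite expn0 /= expr1.
  have -> : (2 ^ k.+1).-1 = ((2 ^ k).-1 + (2 ^ k).-1).+1.
    by rewrite expnS mul2n -addnn -{1 2}(prednK (expn_gt0 2 k)) addnS.
  by rewrite -spowD semi_sq ?star_spow // IH -exprM expnSr.
apply/eqP; rewrite eq_le semi_spow_le /=.
have [x0|xn0] := eqVneq (N x) 0; first by rewrite x0 expr0n.
have x0 : 0 < N x by rewrite lt_def xn0 N0.
have lt_n : (n.+1 < 2 ^ n.+1)%N by rewrite ltn_expl.
have := semiM HN (spow x n) (spow x (2 ^ n.+1 - n.+2)); rewrite spowD.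
have -> : (n + (2 ^ n.+1 - n.+2)).+1 = (2 ^ n.+1).-1.
  by rewrite -addSn -[in RHS](subnKC lt_n) addSn.
rewrite pow2 => H.
rewrite -(ler_pM2r (exprn_gt0 (2 ^ n.+1 - n.+2).+1 x0)) -exprD.
have -> : (n.+1 + (2 ^ n.+1 - n.+2).+1 = 2 ^ n.+1)%N.
  by rewrite -[in RHS](subnKC lt_n) addnS.
by rewrite (le_trans H) // ler_wpM2l // semi_spow_le.
Qed.

(* The approximants of 1 - sqrt (1 - w). *)
Fixpoint sqi (w : D) n : D :=
  if n is n'.+1 then (2^-1 : R)%:C *: (w + sqi w n' ** sqi w n') else 0.

Lemma sqi_comm y w n : y ** w = w ** y -> y ** sqi w n = sqi w n ** y.
Proof.
move=> yw; elim: n => [|n IH] /=; first by rewrite smul0l smul0r.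
by rewrite smulZr smulZl smulDr smulDl yw smulA IH -smulA IH smulA.
Qed.

Lemma sqi_comm2 w m n : sqi w m ** sqi w n = sqi w n ** sqi w m.
Proof. by apply: sqi_comm; rewrite [RHS]sqi_comm. Qed.

Lemma star_sqi w n : star w = w -> star (sqi w n) = sqi w n.
Proof.
move=> sw; elim: n => [|n IH] /=; first by rewrite star0.
by rewrite starZr starD starM IH sw.
Qed.

Lemma sqi_le w n : N w <= 1 -> N (sqi w n) <= rho R n.
Proof.
move=> w1; elim: n => [|n IH] /=; first by rewrite (snorm0 (semiZ HN)).
rewrite (snormr (semiZ HN)) ger0_norm ?invr_ge0 //. rewrite mulrC ler_pM2r ?invr_gt0 //.
rewrite (le_trans (semiD HN _ _)) // lerD // (le_trans (semiM HN _ _)) //.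
by rewrite expr2 ler_pM ?(semi_ge0 HN).
Qed.

(** The approximants commute, so the next difference is half of (r1 - r0)(r1 + r0). The differences
    of [rho] factor in the same way, and dominate factor by factor. *)
Lemma sqi_step w n : N w <= 1 -> N (sqi w n.+1 - sqi w n) <= rho R n.+1 - rho R n.
Proof.
move=> w1; elim: n => [|n IH].
  by have := sqi_le 1 w1; rewrite /= !subr0.
set r1 := sqi w n.+1 in IH *; set r0 := sqi w n in IH *.
have -> : sqi w n.+2 - r1 = (2^-1 : R)%:C *: ((r1 - r0) ** (r1 + r0)).
  rewrite smulBl !smulDr (sqi_comm2 w n n.+1) -/r1 -/r0 opprD addrA addrK.
  rewrite [in LHS]/r1 [sqi w n.+2]/= -/r1 -/r0 -scalerBr; congr (_ *: _).
  by rewrite opprD addrACA subrr add0r.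
rewrite (snormr (semiZ HN)) ger0_norm ?invr_ge0 //.
have -> : rho R n.+2 - rho R n.+1 =
    2^-1 * ((rho R n.+1 - rho R n) * (rho R n.+1 + rho R n)).
  have E k : rho R k.+1 = (1 + rho R k ^+ 2) / 2 by [].
  by rewrite (E n.+1) [X in _ - X = _]E; field.
rewrite ler_wpM2l ?invr_ge0 // (le_trans (semiM HN _ _)) // ler_pM ?(semi_ge0 HN) //.
by rewrite (le_trans (semiD HN _ _)) // lerD // sqi_le.
Qed.

Lemma sqi_sub w m n : N w <= 1 -> (m <= n)%N -> N (sqi w n - sqi w m) <= rho R n - rho R m.
Proof.
move=> w1 /subnK <-; elim: (n - m)%N => [|k IH]; first by rewrite !subrr (snorm0 (semiZ HN)).
rewrite addSn -(subrK (sqi w (k + m)) (sqi w _.+1)) -addrA.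
rewrite (le_trans (semiD HN _ _)) //.
rewrite -(subrK (rho R (k + m)) (rho R _.+1)) -addrA lerD //; exact: sqi_step.
Qed.

(** The defect in w + s^2 = 2s, that is in (1 - s)^2 = 1 - w, is twice the next step of the
    iteration, hence small by [sqi_step]. *)
Lemma sqi_eq w n :
  w + sqi w n ** sqi w n - (sqi w n + sqi w n) = 2%:C *: (sqi w n.+1 - sqi w n).
Proof.
rewrite scalerBr /= scalerA -rmorphM mulfV ?pnatr_eq0 // scale1r; congr (_ - _).
by rewrite (rmorphD (real_complex R) 1 1) scalerDl rmorph1 scale1r.
Qed.

End SemiTheory.

(** * Positivity in a unital algebra with a C*-seminorm *)

Section Unital.
Variables (R : realType) (U : starAlgType R) (e : U) (N : U -> R).
Hypotheses (el : left_id e smul) (er : right_id e smul) (HN : cstar_semi N).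
Implicit Types (h k u v w x y z : U) (t d : R).

Let N0 := semi_ge0 HN.
Let ND := semiD HN.
Let NZ := semiZ HN.
Let NM := semiM HN.
Let NB := snormB ND NZ.
Let Nr := snormr NZ.

Lemma star_one : star e = e.
Proof. by have := congr1 (@star R U) (er (star e)); rewrite starM starK er. Qed.

Lemma semi_one : N e <= 1.
Proof.
have := semiE HN e; rewrite star_one el => /eqP; rewrite -subr_eq0.
have -> : N e - N e ^+ 2 = N e * (1 - N e) by ring.
by rewrite mulf_eq0 subr_eq0 => /orP[/eqP->|/eqP<-].
Qed.

Definition sc t : U := t%:C *: e.

Lemma scD t d : sc (t + d) = sc t + sc d.
Proof. by rewrite /sc rmorphD scalerDl. Qed.
Lemma sc1 : sc 1 = e.
Proof. by rewrite /sc rmorph1 scale1r. Qed.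
Lemma sc0 : sc 0 = 0.
Proof. by rewrite /sc rmorph0 scale0r. Qed.
Lemma star_sc t : star (sc t) = sc t.
Proof. by rewrite starZr star_one. Qed.
Lemma smul_scl t x : sc t ** x = t%:C *: x.
Proof. by rewrite smulZl el. Qed.
Lemma smul_scr t x : x ** sc t = t%:C *: x.
Proof. by rewrite smulZr er. Qed.
Lemma semi_sc t : 0 <= t -> N (sc t) <= t.
Proof. by move=> t0; rewrite Nr ger0_norm // ler_piMr // semi_one. Qed.

(** In a C*-algebra the bound confines the spectrum of [h] to [0, 2t]. In this form sums need the
    triangle inequality only. *)
Definition pos h := star h = h /\ exists2 t, 0 <= t & N (sc t - h) <= t.

Lemma posD h k : pos h -> pos k -> pos (h + k).
Proof.
move=> [sh [t t0 ht]] [sk [d d0 kd]]; split; first by rewrite starD sh sk.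
exists (t + d); first exact: addr_ge0.
by rewrite scD opprD addrACA (le_trans (ND _ _)) // lerD.
Qed.

Lemma pos0 : pos 0.
Proof. by split; rewrite ?star0 //; exists 0 => //; rewrite sc0 subr0 (snorm0 NZ). Qed.

Lemma pos_sum I (s : seq I) (F : I -> U) :
  (forall i, pos (F i)) -> pos (\sum_(i <- s) F i).
Proof. by move=> H; apply: big_ind => // [|x y]; [exact: pos0|exact: posD]. Qed.

Lemma posZ t h : 0 <= t -> pos h -> pos (t%:C *: h).
Proof.
move=> t0 [sh [d d0 hd]]; split; first by rewrite starZr sh.
exists (t * d); first exact: mulr_ge0.
by rewrite /sc rmorphM -scalerA -scalerBr Nr ger0_norm // ler_wpM2l.
Qed.

Lemma pos_scB t h : star h = h -> N h <= t -> pos (sc t - h).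
Proof.
move=> sh ht; split; first by rewrite starB star_sc sh.
by exists t; [exact: le_trans ht|rewrite opprB addrC subrK].
Qed.

Lemma pos_sc t : 0 <= t -> pos (sc t).
Proof. by move=> t0; rewrite -[sc t]subr0; apply: pos_scB; rewrite ?star0 ?(snorm0 NZ). Qed.

Lemma asqrt w d : star w = w -> N w <= 1 -> 0 < d ->
  exists k, [/\ star k = k, N (k ** k - (e - w)) <= d
    & forall y, y ** w = w ** y -> y ** k = k ** y].
Proof.
move=> sw w1 d0.
(* The error of the root will be at most (1 - rho)^2, which is below [d] once 1 - rho is below both
   1 and [d]. *)
have [n Hn] := rho_cvg1 (ltac:(by rewrite lt_min ltr01) : 0 < Num.min 1 d).
have [n1 nd] : 1 - rho R n <= 1 /\ 1 - rho R n <= d by move: Hn; rewrite le_min => /andP[].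
exists (e - sqi w n); split.
- by rewrite starB star_one star_sqi.
- have -> : (e - sqi w n) ** (e - sqi w n) - (e - w) =
      2%:C *: (sqi w n.+1 - sqi w n).
    by rewrite -sqi_eq smulBl !smulBr !el er; zmod.
  rewrite Nr ger0_norm // (le_trans (ler_wpM2l _ (sqi_step HN n w1))) //.
  have := rho_le1 R n; rewrite rhoS_sub; nra.
- by move=> y yw; rewrite smulBl smulBr el er (sqi_comm _ yw).
Qed.

Lemma asqrt_pos h d : pos h -> 0 < d ->
  exists k, [/\ star k = k, N (k ** k - h) <= d
    & forall y, y ** h = h ** y -> y ** k = k ** y].
Proof.
move=> [sh [t t0 ht]] d0.
(* The radius [t] can be 0, so the rescaling divides by t + 1. *)
have t1 : 0 < t + 1 by lra.
have ht1 : N (sc (t + 1) - h) <= t + 1.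
  by rewrite scD sc1 -addrA (addrC e) addrA (le_trans (ND _ _)) // lerD // semi_one.
have w1 : N (e - (t + 1)^-1%:C *: h) <= 1.
  have -> : e - (t + 1)^-1%:C *: h = (t + 1)^-1%:C *: (sc (t + 1) - h).
    by rewrite scalerBr scalerA -rmorphM mulVf ?gt_eqF // rmorph1 scale1r.
  by rewrite Nr ger0_norm ?invr_ge0 ?(ltW t1) // mulrC ler_pdivrMr // mul1r.
have sw : star (e - (t + 1)^-1%:C *: h) = e - (t + 1)^-1%:C *: h.
  by rewrite starB star_one starZr sh.
have [k [sk kk ck]] := asqrt sw w1 (divr_gt0 d0 t1).
exists ((Num.sqrt (t + 1))%:C *: k); split; first by rewrite starZr sk.
- rewrite smulZl smulZr scalerA -rmorphM -expr2 sqr_sqrtr ?(ltW t1) //.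
  have -> : (t + 1)%:C *: (k ** k) - h =
      (t + 1)%:C *: (k ** k - (e - (e - (t + 1)^-1%:C *: h))).
    by rewrite subKr scalerBr scalerA -rmorphM mulfV ?gt_eqF // rmorph1 scale1r.
  by rewrite Nr gtr0_norm // -ler_pdivlMl // mulrC.
- move=> y yh; rewrite smulZl smulZr ck //.
  by rewrite smulBl smulBr el er smulZl smulZr yh.
Qed.

(* For commuting self-adjoint k and l, k + il is normal and
   (k + il)^*(k + il) = k^2 + l^2. *)
Lemma semi_re_im k l : star k = k -> star l = l -> k ** l = l ** k ->
  N k ^+ 2 <= N (k ** k + l ** l) /\ N l ^+ 2 <= N (k ** k + l ** l).
Proof.
move=> sk sl kl; pose u := k + 'i%C *: l.
have su : star u = k - 'i%C *: l.
  by rewrite /u starD starZ sk sl -scaleNr; congr (_ + _ *: _); exact: conjCi.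
have <- : star u ** u = k ** k + l ** l.
  rewrite su smulDr !smulBl !smulZl !smulZr kl scalerA -expr2 sqr_i scaleN1r.
  by rewrite opprK addrA subrK.
rewrite semiE //.
have Nhalf x : N (x + x) = 2 * N x.
  by rewrite -{1}(half_dbl (x + x)) scalerDr half_dbl -mulr2n -scaler_nat NZ
    -(rmorph_nat (real_complex R)) normc_real ger0_norm.
have le_sq x : N (x + x) <= N u + N u -> N x ^+ 2 <= N u ^+ 2.
  by rewrite Nhalf => H; rewrite lerXn2r ?nnegrE //; lra.
split; apply: le_sq.
  have -> : k + k = u + star u by rewrite su addrACA subrr addr0.
  by rewrite (le_trans (ND _ _)) // semi_star.
have -> : N (l + l) = N (u - star u).
  have -> : u - star u = 'i%C *: (l + l) by rewrite su /u scalerDr; zmod.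
  by rewrite NZ normc_i mul1r.
by rewrite (le_trans (NB _ _)) // semi_star.
Qed.

(** For commuting approximate roots k of [h] and l of [sc t - h] the sum k^2 + l^2 is close to t,
    and [semi_re_im] bounds N(k)^2 by its norm. The 3 counts the two root errors in that sum and the
    return from k^2 to [h]. *)
Lemma pos_le h t : 0 <= t -> pos h -> pos (sc t - h) -> N h <= t.
Proof.
move=> t0 hp tp; apply: (@le_epsM _ _ _ 3) => // d d0.
have [k [sk kh ck]] := asqrt_pos hp d0.
have [l [sl lh cl]] := asqrt_pos tp d0.
have kl : k ** l = l ** k.
  by apply: cl; rewrite smulBl smulBr smul_scl smul_scr (ck h).
have [k2 _] := semi_re_im sk sl kl.
have kl2 : N (k ** k + l ** l) <= t + 2 * d.
  have -> : k ** k + l ** l = sc t + ((k ** k - h) + (l ** l - (sc t - h))).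
    zmod.
  rewrite (le_trans (ND _ _)) // mulrDl mul1r lerD ?semi_sc //.
  by rewrite (le_trans (ND _ _)) // lerD.
have := snorm_le_sub ND h (k ** k).
rewrite semi_sq // (snormC NZ) => /le_trans; apply; lra.
Qed.

Lemma pos_scB_of_pos h t : pos h -> N h <= t -> N (sc t - h) <= t.
Proof.
move=> hp ht; have t0 := le_trans (N0 h) ht; have [sh _] := hp.
by apply: pos_le => //; [exact: pos_scB|rewrite subKr].
Qed.

(** The radii that witness positivity of the approximants may be unbounded; [pos_scB_of_pos]
    replaces them with the norms, which stay near [N h]. *)
Lemma pos_lim h : star h = h ->
  (forall d, 0 < d -> exists2 g, pos g & N (g - h) <= d) -> pos h.
Proof.
move=> sh H; split => //; exists (N h) => //; apply: (@le_epsM _ _ _ 3) => // d d0.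
have [g gp gh] := H _ d0.
have gd : N g <= N h + d by have := snorm_le_sub ND g h; lra.
have -> : sc (N h) - h = (sc (N h + d) - g) + ((g - h) - sc d) by rewrite scD; zmod.
have := ND (sc (N h + d) - g) ((g - h) - sc d); have := NB (g - h) (sc d).
have := pos_scB_of_pos gp gd; have := semi_sc (ltW d0); lra.
Qed.

(** After scaling to norm at most 1 the radius is 1: a root k of 1 - y^2 makes y^2 + k^2 nearly 1,
    so [semi_re_im] bounds k^2, and with it 1 - y^2. *)
Lemma pos_sq x : star x = x -> pos (x ** x).
Proof.
move=> sx; pose c := (N x + 1)^-1.
have c0 : 0 < N x + 1 by have := N0 x; lra.
suff H y : star y = y -> N y <= 1 -> pos (y ** y).
  have -> : x ** x = (N x + 1)%:C *: ((N x + 1)%:C *: ((c%:C *: x) ** (c%:C *: x))).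
    rewrite smulZl smulZr !scalerA -!rmorphM.
    by rewrite !mulrA mulfK ?gt_eqF // mulfV ?gt_eqF // rmorph1 scale1r.

  apply: posZ (ltW c0) _; apply: posZ (ltW c0) _; apply: H; first by rewrite starZr sx.
  rewrite Nr ger0_norm ?invr_ge0 ?(ltW c0) // mulrC ler_pdivrMr //; lra.
move=> sy y1; split; first by rewrite starM sy.
exists 1 => //; rewrite sc1; apply: (@le_epsM _ _ _ 2) => // d d0.
have sw : star (y ** y) = y ** y by rewrite starM sy.
have w1 : N (y ** y) <= 1 by rewrite (semi_sq HN) // expr_le1.
have [k [sk kk ck]] := asqrt sw w1 d0.
have [_] := semi_re_im sy sk (ck _ (smulA _ _ _)).
have -> : y ** y + k ** k = e + (k ** k - (e - y ** y)) by zmod.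
move/le_trans => /(_ _ (ND _ _)).
have := snorm_le_sub ND (e - y ** y) (k ** k); rewrite (semi_sq HN) // (snormC NZ _ (k ** k)).
by have := semi_one; lra.
Qed.

Lemma pos_mulC v y : pos v -> star y = y -> y ** v = v ** y -> pos (y ** v ** y).
Proof.
move=> vp sy yv; have [sv _] := vp.
apply: pos_lim => [|d d0]; first by rewrite !starM sv sy smulA.
have y1 : 0 < N y ^+ 2 + 1 by have := sqr_ge0 (N y); lra.
have [k [sk kv ck]] := asqrt_pos vp (divr_gt0 d0 y1).
exists ((y ** k) ** (y ** k)); first by apply: pos_sq; rewrite starM sk sy (ck y).
have -> : (y ** k) ** (y ** k) - y ** v ** y = y ** (k ** k - v) ** y.
  by rewrite {2}(ck y yv) smulBr smulBl !smulA.
apply: le_trans (NM _ _) _; apply: le_trans (ler_wpM2r (N0 _) (NM _ _)) _.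
apply: (@le_trans _ _ (N y ^+ 2 * (d / (N y ^+ 2 + 1)))).
  by rewrite mulrAC -expr2 ler_wpM2l // sqr_ge0.
rewrite mulrCA ler_piMr ?(ltW d0) // ler_pdivrMr // mul1r; lra.
Qed.

(** This replaces the equality of the nonzero spectra of z^*z and z z^*. Since z v^n = w^n z, one
    has w^(n+1) = t w^n + z v^n z^*, so the powers of w grow at most like d^n times an affine
    function of n. *)
Lemma semi_swap z t d : 0 <= t <= d -> N (sc t + star z ** z) <= d ->
  N (sc t + z ** star z) <= d.
Proof.
move=> /andP[t0 td] vd; set v := sc t + _ in vd; set w := sc t + _.
have d0 := le_trans t0 td; pose K := N z ^+ 2; have K0 : 0 <= K := sqr_ge0 _.
have zK u : N (z ** u ** star z) <= K * N u.
  rewrite (le_trans (NM _ _)) // (semi_star HN) mulrC /K expr2 -mulrA.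
  by rewrite ler_wpM2l // NM.
have sw : star w = w by rewrite starD starM starK star_sc.
have zv n : z ** spow v n = spow w n ** z.
  have zv1 : z ** v = w ** z by rewrite smulDr smulDl smul_scl smul_scr smulA.
  by elim: n => //= n IH; rewrite smulA zv1 -smulA IH smulA.
apply: (@pow_growth _ _ _ (d + K) K 1) => // n.
rewrite addn1 -(semi_spow HN) //.
elim: n => [|n IH].
  rewrite mulr0 addr0 expr0 mulr1 (le_trans (ND _ _)) // lerD //.
    exact: le_trans (semi_sc t0) td.
  by rewrite (le_trans (NM _ _)) // (semi_star HN).
rewrite -spowSr {2}/w smulDr smul_scr smulA -zv.
apply: le_trans (ND _ _) _; rewrite Nr ger0_norm //.
have H1 : N (spow v n) <= d ^+ n.+1.
  by apply: le_trans (semi_spow_le HN _ _) _; rewrite lerXn2r ?nnegrE.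
have H2 : t * N (spow w n) <= d * ((d + K + K * n%:R) * d ^+ n).
  exact: ler_pM.
have H3 : N (z ** spow v n ** star z) <= K * d ^+ n.+1.
  by apply: le_trans (zK _) _; rewrite ler_wpM2l.
apply: le_trans (lerD H2 H3) _; rewrite -natr1 exprS.
by rewrite le_eqVlt; apply/orP; left; apply/eqP; ring.
Qed.

Lemma pos_swap z d : 0 <= d -> pos (sc d - star z ** z) -> pos (sc d - z ** star z).
Proof.
move=> d0 [_ [t t0 ht]]; split; first by rewrite starB star_sc starM starK.
exists (t + d); first exact: addr_ge0.
have -> : sc (t + d) - (sc d - z ** star z) = sc t + z ** star z by rewrite scD; zmod.
apply: semi_swap; first by rewrite t0 lerDl.
have -> : sc t + star z ** z = (sc t - (sc d - star z ** z)) + sc d by zmod.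
by rewrite (le_trans (ND _ _)) // lerD // semi_sc.
Qed.

(** Here the exponent is [n], in contrast to [spow]: the unit supplies the power 0. *)
Definition pw w n := iter n (smul w) e.

Lemma pwSr w n : pw w n.+1 = pw w n ** w.
Proof. by elim: n => [|n IH]; rewrite /= ?er ?el // -smulA -IH. Qed.
Lemma pw_spow w n : pw w n.+1 = spow w n.
Proof. by elim: n => [|n IH]; rewrite /= ?er // -IH. Qed.
Lemma star_pw w n : star w = w -> star (pw w n) = pw w n.
Proof. by move=> sw; case: n => [|n]; rewrite ?star_one // pw_spow star_spow. Qed.
Lemma pw_comm y w n : y ** w = w ** y -> y ** pw w n = pw w n ** y.
Proof.
move=> yw; elim: n => [|n IH] /=; first by rewrite el er.
by rewrite smulA yw -smulA IH smulA.
Qed.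
Lemma pwD w m n : pw w (m + n) = pw w m ** pw w n.
Proof. by elim: m => [|m IH]; rewrite ?el //= IH smulA. Qed.

(** Two factors [w] move into the square, w^(n+2) y^2 = w^n (w y)^2, until the exponent is 0 or
    1. *)
Lemma pos_pw_mul w y n : pos w -> star y = y -> y ** w = w ** y ->
  pos (pw w n ** (y ** y)).
Proof.
move=> wp; have [sw _] := wp.
elim/ltn_ind: n y => -[|[|n]] IH y sy yw.
- by rewrite el; exact: pos_sq.
- by rewrite /= er smulA -yw; exact: pos_mulC.
have -> : pw w n.+2 ** (y ** y) = pw w n ** ((w ** y) ** (w ** y)).
  by rewrite !pwSr -!smulA; congr (_ ** (_ ** _)); rewrite !smulA yw.
apply: IH => //; first by rewrite starM sy sw.
by rewrite -smulA yw.
Qed.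

Lemma pos_pw w n : pos w -> pos (pw w n).
Proof. by move=> wp; have := pos_pw_mul n wp star_one; rewrite !er el; apply. Qed.

(* The terms w^n (1 - w) decrease in n and telescope to 1 - w^n. *)
Lemma pos_telescope w n : pos w -> pos (e - (pw w n ** (e - w)) *+ n).
Proof.
move=> wp; have [sw _] := wp.
suff H : pos (e - pw w n - (pw w n ** (e - w)) *+ n).
  have := posD H (pos_pw n wp); congr pos.
  by move: (_ *+ n) => X; zmod.
elim: n => [|n IH]; first by rewrite subrr sub0r mulr0n oppr0; exact: pos0.
have : pos (pw w n ** ((e - w) ** (e - w))).
  by apply: pos_pw_mul => //; rewrite ?starB ?star_one ?sw // smulBl smulBr el er.
have -> : pw w n ** ((e - w) ** (e - w)) = pw w n ** (e - w) - pw w n.+1 ** (e - w).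
  by rewrite pwSr -smulA -smulBr smulBl el.
move: (pw w n.+1 ** _) => D1; have : pw w n ** (e - w) = pw w n - pw w n.+1.
  by rewrite smulBr er pwSr.
move: IH; move: (pw w n ** _) => D0 IH ED Dp.
have Dn : pos ((D0 - D1) *+ n.+1).
  by rewrite -[n.+1]card_ord -sumr_const; apply: pos_sum.
have := posD IH Dn; congr pos; rewrite mulrnBl [D0 *+ n.+1]mulrSr.
move: (D0 *+ n) (D1 *+ n.+1) => X Y; rewrite ED; zmod.
Qed.

(* Kaplansky's argument: for z = x w^m with w = 1 - x^*x, the upper bound 1/2m of
   z^*z = w^2m (1 - w) passes to z z^*, and z^*z + z z^* is positive; so
   w^2m (1 - w) is small, which forces N w <= 1. *)
Lemma pos_star x : pos (star x ** x).
Proof.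
have c0 : 0 < N x + 1 by have := N0 x; lra.
suff H y : N y <= 1 -> pos (star y ** y).
  have -> : star x ** x = (N x + 1)%:C *: ((N x + 1)%:C *:
      (star ((N x + 1)^-1%:C *: x) ** ((N x + 1)^-1%:C *: x))).
    rewrite starZr smulZl smulZr !scalerA -!rmorphM !mulrA mulfK ?gt_eqF //.
    by rewrite mulfV ?gt_eqF // rmorph1 scale1r.
  apply: posZ (ltW c0) _; apply: posZ (ltW c0) _; apply: H.
  rewrite Nr ger0_norm ?invr_ge0 ?(ltW c0) // mulrC ler_pdivrMr //; lra.
move=> y1; have sh : star (star y ** y) = star y ** y by rewrite starM starK.
split => //; exists 1 => //; rewrite sc1; set w := e - _.
have sw : star w = w by rewrite starB star_one sh.
have h1 : N (star y ** y) <= 1 by rewrite (semiE HN) expr_le1.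
have wp : pos w by rewrite /w -sc1; exact: pos_scB.
have key m : (0 < m)%N ->
    N (pw w (m + m) ** (e - w)) <= 3 / m%:R.
  move=> m0; pose z := y ** pw w m; pose d : R := m%:R^-1.
  have m1 : 0 < m%:R :> R by rewrite ltr0n.
  have d0 : 0 < d by rewrite invr_gt0.
  have yyw : star y ** y = e - w by rewrite /w subKr.
  have zz : star z ** z = pw w (m + m) ** (e - w).
    rewrite starM (star_pw _ sw) -smulA (smulA (star y)) yyw pwD -smulA; congr (_ ** _).
    by rewrite (pw_comm _) // smulBl smulBr el er.
  have zp : pos (sc d - star z ** z).
    have := pos_telescope (m + m) wp; rewrite -zz => H.
    have -> : sc d - star z ** z =
        (d / 2)%:C *: (e - (star z ** z) *+ (m + m)) + sc (d / 2).
      rewrite scalerBr -(scaler_nat _ (star z ** z)) scalerA.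
      rewrite -(rmorph_nat (real_complex R)) -rmorphM.
      have -> : d / 2 * (m + m)%:R = 1.
        by rewrite /d natrD; field; rewrite gt_eqF.
      have -> : sc d = sc (d / 2) + sc (d / 2) by rewrite -scD; congr sc; field.
      by rewrite rmorph1 scale1r -/(sc _); zmod.
    by apply: posD; [apply: posZ => //|apply: pos_sc]; rewrite divr_ge0 // ltW.
  have zp' := pos_swap (ltW d0) zp.
  (* Half the sum of the squares of the self-adjoint elements z + z^* and i (z - star z). *)
  have sp : pos (star z ** z + z ** star z).
    have -> : star z ** z + z ** star z = (2^-1)%:C *:
        ((z + star z) ** (z + star z) +
         ('i%C *: (z - star z)) ** ('i%C *: (z - star z))).
      rewrite smulZl smulZr scalerA -expr2 sqr_i scaleN1r.
      rewrite -[LHS]half_dbl; congr (_ *: _).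
      by rewrite !smulDr !smulDl !smulNr !smulNl; zmod.
    apply: posZ; first by rewrite invr_ge0.
    apply: posD; apply: pos_sq; first by rewrite starD starK addrC.
    rewrite starZ starB starK -opprB scalerN -scaleNr; congr (_ *: _).
    by rewrite -[RHS]opprK; congr (- _); exact: conjCi.
  rewrite -zz.
  have dz : N (star z ** z + sc d) <= d + d.
    apply: pos_le; first by rewrite addr_ge0 // ltW.
      have -> : star z ** z + sc d = (star z ** z + z ** star z) + (sc d - z ** star z) by zmod.
      exact: posD.
    have -> : sc (d + d) - (star z ** z + sc d) = sc d - star z ** z by rewrite scD; zmod.
    exact: zp.
  have := snorm_le_sub ND (star z ** z) (star z ** z + sc d).
  have -> : star z ** z - (star z ** z + sc d) = - sc d by zmod.
  rewrite (snormN NZ) -/d; have := semi_sc (ltW d0); lra.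
(* If N w > 1, then by [semi_spow] the norm of w^2m (1 - w) is at least N w - 1, which exceeds 3/m
   for large m. *)
rewrite leNgt; apply/negP => w1.
have w0 : 0 < N w by exact: lt_trans w1.
have [m] := natr_unbounded 3 (ltac:(lra) : 0 < N w - 1).
case: m => [|m Hm]; first by rewrite mul0r; lra.
have m1 : 0 < m.+1%:R :> R by rewrite ltr0n.
have := key m.+1 isT; rewrite ler_pdivlMr // leNgt => /negP; apply.
apply: lt_le_trans Hm _; rewrite mulrC ler_wpM2r //.
rewrite smulBr er -pwSr.
have := snorm_le_sub ND (pw w (m.+1 + m.+1).+1) (pw w (m.+1 + m.+1)).
rewrite (snormC NZ) addSn !pw_spow !(semi_spow HN) //.
set M := (m + _).+1; have := bernoulli M (ltac:(lra) : 0 <= N w - 1).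
rewrite [1 + (_ - 1)]addrC subrK [_ ^+ M.+1]exprS.
move: (N w ^+ M) (N (spow w _ - _)) => a D Ba H.
have M0 : 0 <= M%:R :> R by [].
have a1 : 1 <= a by apply: le_trans Ba; rewrite lerDl mulr_ge0 // subr_ge0 ltW.
nra.
Qed.

Lemma pos_monotone h k : pos h -> pos k -> N h <= N (h + k).
Proof.
move=> hp kp; apply: pos_le => //.
have -> : sc (N (h + k)) - h = (sc (N (h + k)) - (h + k)) + k by zmod.
apply: posD => //; apply: pos_scB => //.
by have [sh _] := hp; have [sk _] := kp; rewrite starD sh sk.
Qed.

End Unital.

(** * Operator norms and the unitization *)

Section OperatorNorm.
Variables (R : realType) (V : lmodType R[i]) (n : V -> R).
Hypothesis n0 : forall x, 0 <= n x.
Hypothesis nD : forall x y, n (x + y) <= n x + n y.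
Hypothesis nZ : forall (z : R[i]) x, n (z *: x) = normc z * n x.

Definition opn (f : V -> V) : R :=
  sup [set n (f v) | v in [set v | n v <= 1]]%classic.

Lemma opn_le f K : 0 <= K -> (forall v, n (f v) <= K * n v) -> opn f <= K.
Proof.
move=> K0 H; apply: ge_sup.
  by exists (n (f 0)), 0 => //=; rewrite (snorm0 nZ).
by move=> _ [v /= v1 <-]; rewrite (le_trans (H v)) // ler_piMr.
Qed.

Variable f : V -> V.
Hypothesis fZ : forall (z : R[i]) v, f (z *: v) = z *: f v.
Hypothesis fbnd : exists K, forall v, n (f v) <= K * n v.

Lemma opn_sup v : n v <= 1 -> n (f v) <= opn f.
Proof.
move=> v1; apply: ub_le_sup; last by exists v.
have [K H] := fbnd; exists `|K| => _ [u /= u1 <-].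
rewrite (le_trans (H u)) // (le_trans (ler_wpM2r (n0 u) (ler_norm K))) //.
by rewrite ler_piMr.
Qed.

Lemma opn_ge0 : 0 <= opn f.
Proof. by apply: le_trans (n0 _) (opn_sup (v := 0) _); rewrite (snorm0 nZ). Qed.

Lemma opn_ub v : n (f v) <= opn f * n v.
Proof.
(* A null vector cannot be normalized; boundedness makes its image null as well. *)
have [v0|vn0] := eqVneq (n v) 0.
  by have [K /(_ v)] := fbnd; rewrite v0 !mulr0.
have v0 : 0 < n v by rewrite lt_def vn0 n0.
have := opn_sup (v := (n v)^-1%:C *: v).
rewrite fZ !(snormr nZ) ger0_norm ?invr_ge0 // mulVf // => /(_ (lexx _)).
by rewrite mulrC ler_pdivrMr.
Qed.

End OperatorNorm.

(** * C*-seminorms defined by actions *)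

Section ActionNorm.
Variables (R : realType) (V : lmodType R[i]) (n : V -> R).
Hypothesis n0 : forall x, 0 <= n x.
Hypothesis nD : forall x y, n (x + y) <= n x + n y.
Hypothesis nZ : forall (z : R[i]) x, n (z *: x) = normc z * n x.
Variables (D : starAlgType R) (act : D -> V -> V).
Hypothesis aD : forall x y v, act (x + y) v = act x v + act y v.
Hypothesis aZ : forall (z : R[i]) x v, act (z *: x) v = z *: act x v.
Hypothesis aM : forall x y v, act (x ** y) v = act x (act y v).
Hypothesis vZ : forall (z : R[i]) x v, act x (z *: v) = z *: act x v.
Hypothesis abnd : forall x, exists K, forall v, n (act x v) <= K * n v.
Hypothesis aE : forall x K, 0 <= K ->
  (forall v, n (act (star x ** x) v) <= K * n v) ->
  forall v, n (act x v) ^+ 2 <= K * n v ^+ 2.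

Let N x := opn n (act x).

Let N0 x : 0 <= N x.
Proof. by apply: opn_ge0. Qed.
Let Nub x v : n (act x v) <= N x * n v.
Proof. by apply: opn_ub. Qed.

(** [aE] stands for the inequality |x v|^2 <= |x^*x| |v|^2 of Hilbert modules. It gives N(x)^2 <=
    N(star x ** x) <= N(star x) N(x); cancelling a factor makes N invariant under [star], which
    closes the C*-identity. *)
Lemma action_semi : cstar_semi N.
Proof.
have NM x y : N (x ** y) <= N x * N y.
  apply: opn_le => [//||v]; first exact: mulr_ge0.
  by rewrite aM (le_trans (Nub _ _)) // -mulrA ler_wpM2l.
have sq_le x : N x ^+ 2 <= N (star x ** x).
  rewrite -[leRHS]sqr_sqrtr // lerXn2r ?nnegrE ?sqrtr_ge0 //.
  apply: opn_le => [//||v]; first exact: sqrtr_ge0.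
  rewrite -(@ler_pXn2r _ 2) ?nnegrE ?mulr_ge0 ?sqrtr_ge0 //.
  by rewrite exprMn sqr_sqrtr //; apply: aE.
have star_le x : N x <= N (star x).
  have := le_trans (sq_le x) (NM _ _); rewrite expr2.
  by have := N0 x; rewrite le_eqVlt => /predU1P[<-//|x0]; rewrite ler_pM2r.
have Nz z x : N (z *: x) <= normc z * N x.
  have z0 : 0 <= normc z by case: (z) => a b; exact: sqrtr_ge0.
  apply: opn_le => [//||v]; first exact: mulr_ge0.
  by rewrite aZ nZ -mulrA ler_wpM2l.
split => //.
- move=> x y; apply: opn_le => [//||v]; first exact: addr_ge0.
  by rewrite aD mulrDl (le_trans (nD _ _)) // lerD.
- move=> z x; apply/eqP; rewrite eq_le Nz /=.
  have [->|zn0] := eqVneq z 0; first by rewrite ComplexField.Normc.normc0 mul0r.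
  have zn : 0 < normc z.
    rewrite lt_def; apply/andP; split; last by case: (z) => a b; exact: sqrtr_ge0.
    by apply: contra_neq zn0 => /ComplexField.Normc.eq0_normc.
  rewrite -ler_pdivlMl // -ComplexField.Normc.normcV -{1}[x](scalerK zn0); exact: Nz.
- move=> x; apply/eqP; rewrite eq_le sq_le andbT (le_trans (NM _ _)) // expr2.
  by rewrite ler_wpM2r // -{2}[x]starK.
Qed.

End ActionNorm.

Definition unitization (R : realType) (T : starAlgType R) := (R[i] * T)%type.

Section Unitization.
Variables (R : realType) (T : starAlgType R).
Local Notation U := (unitization T).

HB.instance Definition _ := GRing.Lmodule.on U.

Definition usmul (u v : U) : U :=
  (u.1 * v.1, u.1 *: v.2 + v.1 *: u.2 + u.2 ** v.2).
Definition ustar (u : U) : U := ((u.1)^*, star u.2).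
Definition uone : U := (1, 0).
Definition uemb (a : T) : U := (0, a).
Definition uact (u : U) (y : T) : T := u.1 *: y + u.2 ** y.

Lemma usmulA : associative usmul.
Proof.
move=> [a x] [b y] [c z]; rewrite /usmul /=; congr (_, _); first by rewrite mulrA.
rewrite !scalerDr !smulDr !smulDl !smulZl !smulZr !scalerA smulA.
by rewrite (mulrC c a) (mulrC c b) -!scalerA; zmod.
Qed.
Lemma usmulDl : left_distributive usmul +%R.
Proof.
move=> [a x] [b y] [c z]; rewrite /usmul /=; congr (_, _); first by rewrite mulrDl.
rewrite scalerDl !scalerDr smulDl /=; zmod.
Qed.
Lemma usmulDr : right_distributive usmul +%R.
Proof.
move=> [a x] [b y] [c z]; rewrite /usmul /=; congr (_, _); first by rewrite mulrDr.
rewrite scalerDl !scalerDr smulDr /=; zmod.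
Qed.
Lemma usmulZl (k : R[i]) u v : usmul (k *: u) v = k *: usmul u v.
Proof.
case: u v => [a x] [b y]; rewrite /usmul /=; congr (_, _); first by rewrite -scalerAl.
by rewrite !scalerDr !scalerA smulZl (mulrC b).
Qed.
Lemma usmulZr (k : R[i]) u v : usmul u (k *: v) = k *: usmul u v.
Proof.
case: u v => [a x] [b y]; rewrite /usmul /=; congr (_, _); first exact: mulrCA.
by rewrite !scalerDr !scalerA smulZr (mulrC a).
Qed.
Lemma ustarK : involutive ustar.
Proof. by move=> [a x]; rewrite /ustar /= conjCK starK. Qed.
Lemma ustarD : {morph ustar : x y / x + y}.
Proof. by move=> [a x] [b y]; rewrite /ustar /= rmorphD starD. Qed.
Lemma ustarZ (z : R[i]) x : ustar (z *: x) = z^* *: ustar x.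
Proof. by case: x => a x; rewrite /ustar /= rmorphM starZ. Qed.
Lemma ustarM x y : ustar (usmul x y) = usmul (ustar y) (ustar x).
Proof.
case: x y => [a x] [b y]; rewrite /ustar /usmul /= rmorphM mulrC.
by rewrite !starD !starZ starM (addrC (_ *: _)).
Qed.

HB.instance Definition _ := Lmodule_isStarAlgebra.Build R U
  usmulA usmulDl usmulDr usmulZl usmulZr ustarK ustarD ustarZ ustarM.

Lemma uone_l : left_id uone smul.
Proof.
by move=> [a x]; congr (_, _) => /=; rewrite ?mul1r // scaler0 smul0l scale1r !addr0.
Qed.
Lemma uone_r : right_id uone smul.
Proof.
by move=> [a x]; congr (_, _) => /=; rewrite ?mulr1 // scaler0 smul0r scale1r add0r addr0.
Qed.

Lemma uembD x y : uemb (x + y) = uemb x + uemb y.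
Proof. by congr (_, _); rewrite /= addr0. Qed.
Lemma uembZ (z : R[i]) x : uemb (z *: x) = z *: uemb x.
Proof. by congr (_, _); rewrite /= scaler0. Qed.
Lemma uembB x y : uemb (x - y) = uemb x - uemb y.
Proof. by congr (_, _); rewrite /= subr0. Qed.
Lemma uembM x y : uemb (x ** y) = uemb x ** uemb y.
Proof. by congr (_, _) => /=; rewrite ?mulr0 // !scale0r !add0r. Qed.
Lemma uembS x : uemb (star x) = star (uemb x).
Proof. by congr (_, _) => /=; rewrite rmorph0. Qed.

Variable q : T -> R.
Hypothesis Hq : cstar_semi q.

(** Operators on [T] alone: if [T] has a unit, its difference from [uone] gets seminorm 0. *)
Definition unorm : U -> R := fun u => opn q (uact u).

Lemma uactM u v y : uact (u ** v) y = uact u (uact v y).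
Proof.
case: u v => [a x] [b z]; rewrite /uact /= !scalerDr !smulDl smulDr smulZr scalerA.
by rewrite !smulZl smulA -!scalerA; zmod.
Qed.

Lemma uact_adj u x y : star (uact u x) ** y = star x ** uact (star u) y.
Proof.
by rewrite /uact /= starD starM starZ smulDl smulDr smulZl smulZr smulA.
Qed.

Lemma uact_bnd u y : q (uact u y) <= (normc u.1 + q u.2) * q y.
Proof.
by rewrite mulrDl (le_trans (semiD Hq _ _)) // lerD ?(semiM Hq) // (semiZ Hq).
Qed.

Lemma unorm_semi : cstar_semi unorm.
Proof.
have q0 := semi_ge0 Hq; have qD := semiD Hq; have qZ := semiZ Hq.
apply: action_semi => //.
- by move=> x y v; rewrite /uact /= scalerDl smulDl; zmod.
- by move=> z x v; rewrite /uact scalerDr smulZl scalerA.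
- exact: uactM.
- by move=> z x v; rewrite /uact scalerDr smulZr !scalerA mulrC.
- by move=> x; exists (normc x.1 + q x.2) => v; exact: uact_bnd.
move=> x K K0 H v.
rewrite -(semiE Hq) uact_adj -uactM (le_trans (semiM Hq _ _)) // (semi_star Hq).
by rewrite mulrC expr2 mulrA ler_wpM2r.
Qed.

Lemma unorm_emb a : unorm (uemb a) = q a.
Proof.
have q0 := semi_ge0 Hq; have qD := semiD Hq; have qZ := semiZ Hq.
have aE y : uact (uemb a) y = a ** y by rewrite /uact scale0r add0r.
apply/eqP; rewrite eq_le; apply/andP; split.
  by apply: (opn_le qZ) => // v; rewrite aE (semiM Hq).
have [->|an0] := eqVneq (q a) 0; first exact: (semi_ge0 unorm_semi).
have a0 : 0 < q a by rewrite lt_def an0 q0.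
(* The test vector is a^*, with image a a^* of norm q(a)^2. *)
rewrite -(ler_pM2r a0) -expr2 -{1}(semi_star Hq) -(semiE Hq) starK -aE.
rewrite -[X in _ * X](semi_star Hq); apply: opn_ub => //.
  by move=> z v; rewrite /uact scalerDr smulZr !scalerA mulrC.
by exists (normc 0 + q a) => v; exact: (uact_bnd (uemb a)).
Qed.

(* Positivity in the completion of T, expressed without completing. *)
Definition spos (h : T) := pos uone unorm (uemb h).

Let ul := uone_l. Let ur := uone_r. Let HU := unorm_semi.

Lemma sposD h k : spos h -> spos k -> spos (h + k).
Proof. by rewrite /spos uembD; exact: posD. Qed.
Lemma spos0 : spos 0.
Proof. exact: pos0. Qed.
Lemma spos_sum I (s : seq I) (F : I -> T) :
  (forall i, spos (F i)) -> spos (\sum_(i <- s) F i).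
Proof. by move=> H; apply: big_ind => // [|x y]; [exact: spos0|exact: sposD]. Qed.
Lemma sposZ (t : R) h : 0 <= t -> spos h -> spos (t%:C *: h).
Proof. by rewrite /spos uembZ; exact: posZ. Qed.
Lemma spos_star x : spos (star x ** x).
Proof. by rewrite /spos uembM uembS; exact: pos_star. Qed.
Lemma spos_monotone h k : spos h -> spos k -> q h <= q (h + k).
Proof. by move=> hp kp; rewrite -!unorm_emb uembD; exact: pos_monotone. Qed.
Lemma spos_lim h : star h = h ->
  (forall d, 0 < d -> exists2 g, spos g & q (g - h) <= d) -> spos h.
Proof.
move=> sh H; apply: pos_lim => // [|d /H[g gp gh]]; first by rewrite -uembS sh.
by exists (uemb g) => //; rewrite -uembB unorm_emb.
Qed.

End Unitization.

(** * Modules with an inner product *)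

Section InnerProduct.
Variables (R : realType) (T : starAlgType R) (q : T -> R) (E : lmodType R[i]).
Variable r : E -> E -> T.

Record inner_product : Prop := {
  ipDr : forall x y z, r x (y + z) = r x y + r x z;
  ipZr : forall (z : R[i]) x y, r x (z *: y) = z *: r x y;
  ipS : forall x y, star (r x y) = r y x;
  ip_spos : forall x, spos q (r x x)
}.

Hypotheses (Hq : cstar_semi q) (Hr : inner_product).
Implicit Types (x y z : E).

Let q0 := semi_ge0 Hq.
Let qD := semiD Hq.
Let qZ := semiZ Hq.
Let rDr := ipDr Hr.
Let rZr := ipZr Hr.

Lemma ipDl x y z : r (x + y) z = r x z + r y z.
Proof. by rewrite -(ipS Hr) rDr starD !(ipS Hr). Qed.
Lemma ipZl (a : R[i]) x y : r (a *: x) y = a^* *: r x y.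
Proof. by rewrite -(ipS Hr) rZr starZ (ipS Hr). Qed.
Lemma ipNr x y : r x (- y) = - r x y.
Proof. by rewrite -scaleN1r rZr scaleN1r. Qed.
Lemma ipNl x y : r (- x) y = - r x y.
Proof. by rewrite -(ipS Hr) ipNr starN (ipS Hr). Qed.
Lemma ipZlr (t : R) x y : r (t%:C *: x) y = t%:C *: r x y.
Proof. by rewrite ipZl conjCr. Qed.

Definition ipn x : R := Num.sqrt (q (r x x)).

Lemma ipn_ge0 x : 0 <= ipn x.
Proof. exact: sqrtr_ge0. Qed.
Lemma ipn_sq x : ipn x ^+ 2 = q (r x x).
Proof. by rewrite sqr_sqrtr. Qed.

Lemma ipn_le x K : 0 <= K -> q (r x x) <= K ^+ 2 -> ipn x <= K.
Proof. by move=> K0; rewrite -ipn_sq ler_pXn2r ?nnegrE ?ipn_ge0. Qed.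

Lemma ipnZ (a : R[i]) x : ipn (a *: x) = normc a * ipn x.
Proof.
rewrite /ipn ipZl rZr !qZ mulrA -ComplexField.Normc.normcM -normCKC.
have -> : normc (`|a| ^+ 2) = normc a ^+ 2.
  by rewrite -[`|a|]/((normc a)%:C) -rmorphXn normc_real ger0_norm // sqr_ge0.
rewrite sqrtrM ?sqr_ge0 // sqrtr_sqr ger0_norm //.
by case: (a) => ? ?; exact: sqrtr_ge0.
Qed.

Lemma ipn_monotone x y : q (r x x) <= q (r x x + r y y).
Proof. by apply: spos_monotone => //; exact: ip_spos. Qed.

(** Cauchy-Schwarz is not yet available. Adding the inner square of s x - s^-1 y with s^2 = b/a
    cancels the mixed terms, and (1 + b/a) a^2 + (1 + a/b) b^2 = (a + b)^2. The shift by d keeps a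
    and b positive. *)
Lemma ipnD x y : ipn (x + y) <= ipn x + ipn y.
Proof.
apply: (@le_epsM _ _ _ 2) => // d d0.
pose a := ipn x + d; pose b := ipn y + d.
have a0 : 0 < a by have := ipn_ge0 x; rewrite /a; lra.
have b0 : 0 < b by have := ipn_ge0 y; rewrite /b; lra.
suff : ipn (x + y) <= a + b by rewrite /a /b; lra.
apply: ipn_le; first by rewrite addr_ge0 // ltW.
pose s := Num.sqrt (b / a).
have ba0 : 0 < b / a by rewrite divr_gt0.
have s0 : 0 < s by rewrite sqrtr_gt0.
have s2 : s * s = b / a by rewrite -expr2 sqr_sqrtr // ltW.
apply: le_trans (ipn_monotone _ (s%:C *: x - s^-1%:C *: y)) _.
have -> : r (x + y) (x + y) + r (s%:C *: x - s^-1%:C *: y) (s%:C *: x - s^-1%:C *: y) =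
    (1 + b / a)%:C *: r x x + (1 + a / b)%:C *: r y y.
  rewrite !ipDl !rDr !ipNl !ipNr !ipZlr !rZr !scalerA -!rmorphM s2.
  rewrite mulVf ?mulfV ?gt_eqF // -invfM s2 invf_div.
  rewrite !rmorphD !scalerDl !rmorph1 !scale1r; zmod.
apply: le_trans (qD _ _) _; rewrite !(snormr qZ).
rewrite !ger0_norm ?addr_ge0 ?divr_ge0 ?(ltW a0) ?(ltW b0) //.
have xa : q (r x x) <= a ^+ 2.
  by rewrite -ipn_sq lerXn2r ?nnegrE ?ipn_ge0 ?(ltW a0) // lerDl ltW.
have yb : q (r y y) <= b ^+ 2.
  by rewrite -ipn_sq lerXn2r ?nnegrE ?ipn_ge0 ?(ltW b0) // lerDl ltW.
apply: (@le_trans _ _ ((1 + b / a) * a ^+ 2 + (1 + a / b) * b ^+ 2)).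
  by rewrite lerD // ler_wpM2l // addr_ge0 // divr_ge0 // ltW.
rewrite le_eqVlt; apply/orP; left; apply/eqP; field.
by rewrite !gt_eqF.
Qed.

Lemma ip_polar x y : r x y = (4^-1 : R)%:C *:
  ((r (x + y) (x + y) - r (x - y) (x - y)) +
   'i%C *: (r ('i%C *: x + y) ('i%C *: x + y) - r ('i%C *: x - y) ('i%C *: x - y))).
Proof.
have -> : r (x + y) (x + y) - r (x - y) (x - y) = (r x y + r y x) *+ 2.
  by rewrite !ipDl !rDr !ipNl !ipNr; zmod.
have -> : r ('i%C *: x + y) ('i%C *: x + y) - r ('i%C *: x - y) ('i%C *: x - y) =
    (- 'i%C *: r x y + 'i%C *: r y x) *+ 2.
  have -> : - 'i%C *: r x y = r ('i%C *: x) y.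
    by rewrite ipZl; congr (_ *: _); symmetry; exact: conjCi.
  have -> : 'i%C *: r y x = r y ('i%C *: x) by rewrite rZr.
  by rewrite !ipDl !rDr !ipNl !ipNr; zmod.
rewrite -(scalerMnr 'i%C) (scalerDr 'i%C) !(scalerA 'i%C).
rewrite mulrN -expr2 sqr_i opprK scale1r scaleN1r.
have -> : (r x y + r y x) *+ 2 + (r x y - r y x) *+ 2 = r x y *+ 4 by zmod.
rewrite -(scaler_nat 4 (r x y)) scalerA -(rmorph_nat (real_complex R)) -rmorphM.
rewrite mulVf ?pnatr_eq0 //.
by rewrite rmorph1 scale1r.
Qed.

(* The optimal constant 1 is not needed, since all uses amplify by powers. *)
Lemma ip_CS x y : q (r x y) <= 4 * ipn x * ipn y.
Proof.
have nD := ipnD; have nZ := ipnZ.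
(* Each of the four polarization terms has norm at most 2^2, and their sum is divided by 4. *)
have weak u v : ipn u <= 1 -> ipn v <= 1 -> q (r u v) <= 4.
  move=> u1 v1; rewrite ip_polar (snormr qZ) ger0_norm ?invr_ge0 // ler_pdivrMl //.
  have n2 s t : ipn s <= 1 -> ipn t <= 1 ->
      q (r (s + t) (s + t) - r (s - t) (s - t)) <= 8.
    move=> s1 t1; have sq z : ipn z <= 2 -> q (r z z) <= 4.
      by move=> z2; rewrite -ipn_sq; have := ipn_ge0 z; nra.
    apply: le_trans (snormB qD qZ _ _) _.
    have := sq (s + t); have := sq (s - t).
    have := nD s t; have := snormB nD nZ s t; lra.
  apply: le_trans (qD _ _) _; rewrite qZ normc_i mul1r.
  have iu : ipn ('i%C *: u) <= 1 by rewrite nZ normc_i mul1r.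
  by have := n2 _ _ u1 v1; have := n2 _ _ iu v1; lra.
apply: (@le_epsM1 _ _ _ (4 * (ipn x + ipn y + 1))) => [|d d0 d1].
  by have := ipn_ge0 x; have := ipn_ge0 y; lra.
have x0 := ipn_ge0 x; have y0 := ipn_ge0 y.
pose a := ipn x + d; pose b := ipn y + d.
have a0 : 0 < a by rewrite /a; lra.
have b0 : 0 < b by rewrite /b; lra.
have := weak (a^-1%:C *: x) (b^-1%:C *: y).
rewrite !(snormr nZ) ipZlr rZr !(snormr qZ) !ger0_norm ?invr_ge0 ?(ltW a0) ?(ltW b0) //.
rewrite !ler_pdivrMl // !mulr1 => H.
have : q (r x y) <= b * (a * 4) by apply: H; rewrite /a /b; lra.
rewrite /a /b; nra.
Qed.

(* Applied to y = f^*f x and z = f x. *)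
Lemma ipn_adj_le x y z K : 0 <= K -> r z z = r x y -> ipn y <= K * ipn x ->
  ipn z ^+ 2 <= K * ipn x ^+ 2.
Proof.
move=> K0 zz yK; rewrite [leLHS]ipn_sq.
apply: (@le_epsM _ _ _ (ipn x ^+ 2)) => [|d d0]; first exact: sqr_ge0.
pose c := K + d; have c0 : 0 < c by rewrite /c; lra.
have xy : r y x = r x y by rewrite -[LHS](ipS Hr) -zz (ipS Hr) zz.
pose s := Num.sqrt c; have s0 : 0 < s by rewrite sqrtr_gt0.
have s2 : s * s = c by rewrite -expr2 sqr_sqrtr // ltW.
(* 2 <z, z> is the mixed part <x, y> + <y, x>; adding the inner square of s x - s^-1 y turns it into
   c <x, x> + c^-1 <y, y>. Unlike [ip_CS], this loses no constant. *)
have := spos_monotone Hq (sposD Hq (ip_spos Hr z) (ip_spos Hr z))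
  (ip_spos Hr (s%:C *: x - s^-1%:C *: y)).
have -> : r z z + r z z + r (s%:C *: x - s^-1%:C *: y) (s%:C *: x - s^-1%:C *: y) =
    c%:C *: r x x + c^-1%:C *: r y y.
  rewrite !ipDl !rDr !ipNl !ipNr !ipZlr !rZr !scalerA -!rmorphM s2 -invfM s2.
  by rewrite mulVf ?mulfV ?gt_eqF // !rmorph1 !scale1r xy zz; zmod.
have -> : q (r z z + r z z) = 2 * q (r z z).
  by rewrite -mulr2n -scaler_nat -(rmorph_nat (real_complex R)) (snormr qZ) ger0_norm.
move/le_trans => /(_ _ (qD _ _)).
rewrite !(snormr qZ) !ger0_norm ?invr_ge0 ?(ltW c0) // -!ipn_sq.
have : c^-1 * ipn y ^+ 2 <= c * ipn x ^+ 2.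
  rewrite ler_pdivrMl //; have := ipn_ge0 x; have := ipn_ge0 y.
  have Kc : K * ipn x <= c * ipn x by rewrite ler_wpM2r ?ipn_ge0 // /c; lra.
  move=> y0 x0; rewrite mulrA -expr2 -exprMn lerXn2r ?nnegrE ?mulr_ge0 ?(ltW c0) //.
  exact: le_trans yK Kc.
rewrite /c; nra.
Qed.

(* f is the operator |x><x| : z |-> x <x, z>. *)
Lemma ip_rank_one_le x (f : E -> E) (act : E -> T -> E) P :
  (forall y z a, r y (act z a) = r y z ** a) ->
  (forall z, f z = act x (r x z)) -> 0 <= P ->
  (forall z, ipn (f z) <= P * ipn z) -> q (r x x) <= P.
Proof.
move=> rA fE P0 fP; pose k := r x x.
have sk : star k = k by exact: ipS.
(* k^(m+1) = <x, f^m x>, of norm at most 4 q(k) P^m by [ip_CS]. *)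
apply: (@pow_growth _ _ _ (4 * q k) 0 1) => // m.
rewrite mul0r addr0 addn1 -(semi_spow Hq) //.
have -> : spow k m = r x (iter m f x).
  by elim: m => //= m ->; rewrite fE rA.
apply: le_trans (ip_CS _ _) _; rewrite -/k -ipn_sq expr2 -!mulrA !ler_wpM2l ?ipn_ge0 //.
elim: m => [|m IH] /=; first by rewrite expr0 mulr1.
by rewrite exprS mulrCA (le_trans (fP _)) // ler_wpM2l.
Qed.

End InnerProduct.

(** * C*-algebras and imprimitivity bimodules *)

Section CStarNorm.
Variables (R : realType) (T : starAlgType R).

Lemma cstar_normRe (p : T -> R[i]) x : cstar_norm p -> p x = (complex.Re (p x))%:C.
Proof.
by move=> Hp; apply/esym/RRe_real/ger0_real/(cstar_norm_ge0 Hp).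
Qed.

Lemma cstar_norm_semi (p : T -> R[i]) :
  cstar_norm p -> cstar_semi (fun x => complex.Re (p x)).
Proof.
move=> Hp; have pE x := cstar_normRe x Hp.
split=> [x|x y|z x|x y|x].
- by rewrite -ler0c -pE (cstar_norm_ge0 Hp).
- by rewrite -lecR rmorphD /= -!pE (cstar_normD Hp).
- by apply: complexI; rewrite rmorphM /= -!pE (cstar_normZ Hp).
- by rewrite -lecR rmorphM /= -!pE (cstar_normM Hp).
- by apply: complexI; rewrite rmorphXn /= -!pE (cstar_normE Hp).
Qed.

Lemma cstar_semi_norm (N : T -> R) : cstar_semi N ->
  (forall x, N x = 0 -> x = 0) -> cstar_norm (fun x => (N x)%:C).
Proof.
move=> HN N0; split=> [x|x /complexI/N0//|x y|z x|x y|x].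
- by rewrite ler0c (semi_ge0 HN).
- by rewrite -rmorphD lecR (semiD HN).
- by rewrite (semiZ HN) rmorphM.
- by rewrite -rmorphM lecR (semiM HN).
- by rewrite (semiE HN) rmorphXn.
Qed.

End CStarNorm.

(** * Complete algebras: exact square roots and contractive actions *)

Section CompleteCStar.
Variables (R : realType) (D : cstarAlgType R).
Implicit Types a s w : D.

Definition nrm a : R := complex.Re `|a|.

Lemma nrmE a : `|a| = (nrm a)%:C.
Proof. exact: (cstar_normRe a (@norm_is_cstar R D)). Qed.

Lemma nrm_semi : cstar_semi nrm.
Proof. exact: (cstar_norm_semi (@norm_is_cstar R D)). Qed.

Lemma nrm_eq0 a : nrm a = 0 -> a = 0.
Proof. by move=> a0; apply/eqP; rewrite -normr_eq0 nrmE a0. Qed.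

Local Open Scope classical_set_scope.

Lemma nrm_complete (u : nat -> D) :
  (forall d : R, 0 < d -> exists N, forall m n,
     (N <= m)%N -> (N <= n)%N -> nrm (u m - u n) < d) ->
  exists l, forall d : R, 0 < d -> exists N, forall n, (N <= n)%N -> nrm (u n - l) < d.
Proof.
move=> uC; have : cvg (u @ \oo).
  apply/cauchy_cvgP/cauchy_ballP => d d0; near_simpl.
  have dE : d = (complex.Re d)%:C by apply/esym/RRe_real/gtr0_real.
  have [N HN] : exists N, forall m n,
      (N <= m)%N -> (N <= n)%N -> nrm (u m - u n) < complex.Re d.
    by apply: uC; rewrite -ltcR -dE.
  near=> m n => /=; rewrite -ball_normE /= nrmE dE ltcR; apply: HN.
    by near: m; exact: nbhs_infty_ge.
  by near: n; exact: nbhs_infty_ge.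
move=> ul; exists (lim (u @ \oo)) => d d0.
have d0C : 0 < d%:C :> R[i] by rewrite ltcR.
have /cvgrPdist_lt /(_ _ d0C) [N _ HN] := ul.
exists N => n Nn; rewrite -ltcR -nrmE distrC; exact: HN.
Unshelve. all: by end_near.
Qed.

Local Close Scope classical_set_scope.

(** The equation is (1 - s)^2 = 1 - w, written without a unit. Completeness provides an exact
    solution, as [ipn_contract] demands: the action there is not known to be bounded, so
    approximation in [D] would give no control over it. *)
Lemma cstar_sqrt w : star w = w -> nrm w <= 1 ->
  exists2 s, star s = s & w + s ** s = s + s.
Proof.
move=> sw w1; have HN := nrm_semi.
have nD := semiD HN; have nZ := semiZ HN; have nM := semiM HN.
have [s Hs] : exists l, forall d : R, 0 < d ->
    exists N, forall n, (N <= n)%N -> nrm (sqi w n - l) < d.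
  apply: nrm_complete => d d0; have [N HN1] := rho_cvg1 (divr_gt0 d0 (ltr0n R 2)).
  exists N => m n; wlog mn : m n / (m <= n)%N => [H|] Nm Nn.
    have [mn|/ltnW mn] := leqP m n; first exact: H.
    by rewrite (snormC nZ); apply: H.
  rewrite (snormC nZ) (le_lt_trans (sqi_sub HN w1 mn)) //.
  have := rho_le1 R n; have := rho_le R Nm; lra.
exists s.
  apply/eqP; rewrite -subr_eq0; apply/eqP/nrm_eq0/eqP.
  rewrite eq_le (semi_ge0 HN) andbT; apply: (@le_epsM _ _ _ 2) => // d d0.
  have [N /(_ _ (leqnn N)) HN1] := Hs _ d0.
  have -> : star s - s = (sqi w N - s) - star (sqi w N - s).
    by rewrite starB star_sqi //; zmod.
  have := snormB nD nZ (sqi w N - s) (star (sqi w N - s)).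
  by rewrite (semi_star HN); lra.
apply/eqP; rewrite -subr_eq0; apply/eqP/nrm_eq0/eqP.
have s0 := semi_ge0 HN s.
rewrite eq_le (semi_ge0 HN) andbT; apply: (@le_epsM _ _ _ (nrm s + 4)) => [|d d0]; first lra.
have [N1 HN1] := Hs _ d0.
have d10 : 0 < Num.min d 1 by rewrite lt_min d0 ltr01.
have [N2 HN2] := rho_cvg1 d10.
pose n := maxn N1 N2; pose u := sqi w n.
have us : nrm (u - s) < d by apply: HN1; rewrite leq_maxl.
have ud : 1 - rho R n <= Num.min d 1.
  by apply: le_trans HN2; rewrite lerD2l lerN2 rho_le // leq_maxr.
move: ud; rewrite le_min => /andP[ud u1].
have uu : nrm (w + u ** u - (u + u)) <= d.
  rewrite sqi_eq (snormr nZ) ger0_norm // (le_trans (ler_wpM2l _ (sqi_step HN n w1))) //.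
  have := rho_le1 R n; rewrite rhoS_sub; nra.
have u1n : nrm u <= 1 := le_trans (sqi_le HN n w1) (rho_le1 R n).
have -> : w + s ** s - (s + s) = (w + u ** u - (u + u)) -
    ((u - s) ** u + s ** (u - s)) + ((u - s) + (u - s)).
  by rewrite smulBl smulBr; zmod.
have := nD ((w + u ** u - (u + u)) - ((u - s) ** u + s ** (u - s))) ((u - s) + (u - s)).
have := snormB nD nZ (w + u ** u - (u + u)) ((u - s) ** u + s ** (u - s)).
have := nD ((u - s) ** u) (s ** (u - s)).
have := nM (u - s) u; have := nM s (u - s); have := nD (u - s) (u - s).
have := semi_ge0 HN (u - s); have := semi_ge0 HN u.
nra.
Qed.

Section Contraction.
Variables (T : starAlgType R) (q : T -> R) (E : lmodType R[i]) (r : E -> E -> T).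
Hypotheses (Hq : cstar_semi q) (Hr : inner_product q r).
Variable act : D -> E -> E.
Hypothesis actD : forall a b x, act (a + b) x = act a x + act b x.
Hypothesis actZ : forall (z : R[i]) a x, act (z *: a) x = z *: act a x.
Hypothesis actM : forall a b x, act (a ** b) x = act a (act b x).
Hypothesis act_adj : forall a x y, r (act a x) y = r x (act (star a) y).

(** Boundedness comes from adjoints alone: for [nrm b <= 1], the identity 1 - b^*b = (1 - s)^2
    becomes <x, x> = <b x, b x> + <x - s x, x - s x>, whose last term is positive. *)
Lemma ipn_contract a x : ipn q r (act a x) <= nrm a * ipn q r x.
Proof.
have HN := nrm_semi; have nZ := ipnZ Hq Hr.
suff H b : nrm b <= 1 -> ipn q r (act b x) <= ipn q r x.
  have [a0|an0] := eqVneq (nrm a) 0.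
    have -> : act a x = 0 by rewrite (nrm_eq0 a0) -(scale0r (0 : D)) actZ scale0r.
    by rewrite a0 mul0r (snorm0 nZ).
  have a0 : 0 < nrm a by rewrite lt_def an0 (semi_ge0 HN).
  have := H ((nrm a)^-1%:C *: a); rewrite actZ (snormr nZ) (snormr (semiZ HN)).
  rewrite ger0_norm ?invr_ge0 ?(ltW a0) // mulVf // => /(_ (lexx _)).
  by rewrite ler_pdivrMl.
move=> b1; have b1' : nrm (star b ** b) <= 1.
  by rewrite (semiE HN) expr_le1 // (semi_ge0 HN).
have sb : star (star b ** b) = star b ** b by rewrite starM starK.
have [s ss sE] := cstar_sqrt sb b1'.
apply: (ipn_le Hq); first exact: ipn_ge0.
rewrite (ipn_sq _ Hq).
have -> : r x x = r (act b x) (act b x) + r (x - act s x) (x - act s x).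
  have E1 : r x (act (star b) (act b x)) + r x (act s (act s x)) =
      r x (act s x) + r x (act s x).
    by rewrite -!(ipDr Hr) -!actM -!actD sE.
  rewrite act_adj (ipDl Hr) (ipNl Hr) !(ipDr Hr) !(ipNr Hr) !act_adj ss.
  have -> : r x (act (star b) (act b x)) =
      r x (act s x) + r x (act s x) - r x (act s (act s x)).
    by rewrite -E1 addrK.
  zmod.
exact: (ipn_monotone Hq Hr).
Qed.

End Contraction.
End CompleteCStar.

Section Full.
Variables (R : realType) (A : cstarAlgType R) (X : Type) (ip : X -> X -> A).
Hypothesis ip_full : full_ip ip.

Lemma full_approx a d : 0 < d -> exists s : seq (R[i] * (X * X)),
  nrm (a - \sum_(p <- s) p.1 *: ip p.2.1 p.2.2) < d.
Proof.
move=> d0; have d0C : 0 < d%:C :> R[i] by rewrite ltcR.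
have [] := ip_full (O := ball a d%:C).
- by exists a; exact: ballxx.
- exact: ball_open.
move=> v [+ [s sS vE]]; rewrite -ball_normE /= nrmE ltcR vE => H.
suff [s' E] : exists s' : seq (R[i] * (X * X)),
    \sum_(p <- s') p.1 *: ip p.2.1 p.2.2 = \sum_(p <- s) p.1 *: p.2.
  by exists s'; rewrite E.
elim: s sS {H vE} => [|[z c] s IH] sS; first by exists [::]; rewrite !big_nil.
have [|s' E] := IH; first by move=> p ps; apply: sS; rewrite inE ps orbT.
have [x [y /= cE]] := sS (z, c) (mem_head _ _).
by exists ((z, (x, y)) :: s'); rewrite !big_cons E cE.
Qed.

(** [star a] is approximated by combinations of inner products, all annihilated by a, so a a^* would
    have norm below |a|^2 if a were not 0. *)
Lemma full_eq0 a : (forall x y, a ** ip x y = 0) -> a = 0.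
Proof.
move=> H; apply: nrm_eq0; apply/eqP; have HN := @nrm_semi R A.
apply/contraT => an0; have a0 : 0 < nrm a by rewrite lt_def an0 (semi_ge0 HN).
have [s Hs] := full_approx (star a) a0.
have : nrm a ^+ 2 < nrm a * nrm a; last by rewrite expr2 ltxx.
rewrite -(semi_star HN a) -(semiE HN) starK.
have -> : a ** star a = a ** (star a - \sum_(p <- s) p.1 *: ip p.2.1 p.2.2).
  rewrite smulBr [X in _ - X](_ : _ = 0) ?subr0 //.
  rewrite (big_morph _ (smulDr a) (smul0r a)) big1 // => p _.
  by rewrite smulZr H scaler0.
by rewrite (le_lt_trans (semiM HN _ _)) // (semi_star HN) ltr_pM2l.
Qed.

End Full.

(** * Adjoints and approximate units in an imprimitivity bimodule *)

Section Bimodule.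
Variables (R : realType) (A B : cstarAlgType R) (X : imprimitivity_bimodule A B).
Local Notation la := (ib_lact (i := X)).
Local Notation ra := (ib_ract (i := X)).
Local Notation l := (ib_lip (i := X)).
Local Notation r := (ib_rip (i := X)).
Implicit Types (a : A) (b : B) (x y z u v : X).

Let HL := ib_left X.
Let HR := ib_right X.
Let NA := @nrm_semi R A.
Let NB := @nrm_semi R B.

Lemma rip_inner_product : inner_product (@nrm R B) r.
Proof.
split; [exact: (ripDr HR)|exact: (ripZr HR)|exact: (rip_star HR)|move=> x].
by have [b ->] := rip_pos HR x; exact: spos_star.
Qed.
Let Hr := rip_inner_product.

Lemma rip_ractl x y b : r (ra x b) y = star b ** r x y.
Proof. by rewrite -(rip_star HR) (rip_act HR) starM (rip_star HR). Qed.

Lemma lip_lactr x y a : l x (la a y) = l x y ** star a.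
Proof. by rewrite -(lip_star HL) (lip_act HL) starM (lip_star HL). Qed.

Lemma lipDr x y z : l x (y + z) = l x y + l x z.
Proof. by rewrite -(lip_star HL) (lipDl HL) starD !(lip_star HL). Qed.
Lemma lipBl x y z : l (x - y) z = l x z - l y z.
Proof. by rewrite (lipDl HL) -scaleN1r (lipZl HL) scaleN1r. Qed.
Lemma lipBr x y z : l z (x - y) = l z x - l z y.
Proof. by rewrite -(lip_star HL) lipBl starB !(lip_star HL). Qed.
Lemma lipZr (c : R[i]) x y : l x (c *: y) = c^* *: l x y.
Proof. by rewrite -(lip_star HL) (lipZl HL) starZ (lip_star HL). Qed.

Lemma lip_spos x : spos (@nrm R A) (l x x).
Proof. by have [a ->] := lip_pos HL x; exact: spos_star. Qed.

Lemma rip_lip_adj u v x y : r (la (l u v) x) y = r x (la (l v u) y).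
Proof. by rewrite !ib_compat rip_ractl (rip_act HR) (rip_star HR). Qed.

(** After right multiplication by [r v w] both sides equal [r (la (l v y) (la a x)) w], because
    [l y v] acts with adjoint [l v y]. Fullness removes the factor. *)
Lemma rip_lact_adj a x y : r (la a x) y = r x (la (star a) y).
Proof.
apply/eqP; rewrite -subr_eq0; apply/eqP/(full_eq0 (@ib_right_full _ _ _ X)) => v w.
rewrite smulBl -!(rip_act HR) ib_bimodule -!ib_compat.
rewrite -(lact_A HL) -[star a ** _](lip_act HL) -!rip_lip_adj.
by rewrite lip_lactr starK (lact_A HL) subrr.
Qed.

Lemma lact_contract a x : ipn (@nrm R B) r (la a x) <= nrm a * ipn (@nrm R B) r x.
Proof.
apply: (ipn_contract NB Hr); [exact: lactDl HL|exact: lactZl HL|exact: lact_A HL|].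
exact: rip_lact_adj.
Qed.

Lemma nrm_rip_le x : nrm (r x x) <= nrm (l x x).
Proof.
apply: (ip_rank_one_le NB Hr (f := la (l x x)) (act := ra)).
- by move=> y z b; exact: (rip_act HR).
- by move=> z; exact: ib_compat.
- exact: semi_ge0 NA _.
- exact: lact_contract.
Qed.

Let U := unitization A.
Let e : U := uone A.
Let el := @uone_l R A.
Let er := @uone_r R A.
Let NU := unorm_semi NA.

Lemma lip_iter_sub (h : A) n x y : star h = h ->
  uemb (l (iter n (fun z => z - la h z) x) (iter n (fun z => z - la h z) y)) =
  pw e (e - uemb h) n ** uemb (l x y) ** pw e (e - uemb h) n.
Proof.
move=> sh; elim: n => [|n IH]; first by rewrite /= el er.
set w := e - uemb h in IH *.
have -> : pw e w n.+1 ** uemb (l x y) ** pw e w n.+1 =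
    w ** (pw e w n ** uemb (l x y) ** pw e w n) ** w.
  by rewrite {2}(pwSr el er) /= !smulA.
rewrite -IH /=; move: (iter n _ x) (iter n _ y) => u v.
rewrite lipBl !lipBr !lip_lactr !(lip_act HL) sh !uembB !uembM.
by rewrite /w !smulBl !smulBr !el !er; zmod.
Qed.

(* With h proportional to the sum of the l x x, the operators 1 - (1 - h)^n form an
   approximate unit for the finitely many vectors of s. *)
Lemma approx_unit (s : seq X) d : 0 < d -> exists t : R, exists m : nat,
  [/\ 0 < t & forall n, (m <= n)%N -> forall x, x \in s ->
     ipn (@nrm R B) r
       (iter n (fun z => z - la (t%:C *: \sum_(x <- s) l x x) z) x) <= d].
Proof.
(* This [t] gives the operator [h] below norm at most 1; the added 1 covers a sum equal to 0. *)
move=> d0; pose t := (\sum_(x <- s) nrm (l x x) + 1)^-1.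
have S0 : 0 <= \sum_(x <- s) nrm (l x x).
  by apply: sumr_ge0 => x _; exact: semi_ge0 NA _.
have t0 : 0 < t by rewrite invr_gt0; lra.
pose h : A := t%:C *: \sum_(x <- s) l x x.
have sh : star h = h.
  rewrite starZr star_sum; congr (_ *: _); apply: eq_bigr => x _.
  exact: lip_star HL _ _.
have h1 : nrm h <= 1.
  rewrite (snormr (semiZ NA)) (ger0_norm (ltW t0)) ler_pdivrMl ?mulr1; last lra.
  by apply: le_trans (snorm_sum (semiD NA) (semiZ NA) _ _) _; rewrite lerDl.
pose w : U := e - uemb h.
have wp : pos e (unorm (@nrm R A)) w.
  have -> : w = sc e 1 - uemb h by rewrite sc1.
  by apply: (pos_scB er NU); rewrite ?unorm_emb // -uembS sh.
have [m Hm] := natr_unbounded (t^-1 * (d ^+ 2)^-1) (ltr0n R 2).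
exists t, m.+1; split=> // n mn x xs.
have n0 : 0 < n%:R :> R by rewrite ltr0n (leq_trans _ mn).
apply: (ipn_le NB); first exact: ltW.
apply: le_trans (nrm_rip_le _) _; rewrite -(unorm_emb NA) -/h.
pose W z : X := z - la h z; pose F z := uemb (l (iter n W z) (iter n W z)).
have Fp z : pos e (unorm (@nrm R A)) (F z) by exact: lip_spos.
(* The left inner squares of the vectors (1 - h)^n z sum to t^-1 w^2n (1 - w), of norm at most
   1/(2nt) by [pos_telescope]. Each summand is bounded by this sum, as all of them are positive. *)
pose g := pw e w (n + n) ** (e - w).
have gE : t%:C *: \sum_(z <- s) F z = g.
  rewrite /F (eq_bigr (fun z => pw e w n ** uemb (l z z) ** pw e w n)); last first.
    by move=> z _; rewrite lip_iter_sub.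
  rewrite -smul_suml -(big_morph _ (smulDr (pw e w n)) (smul0r _)).
  rewrite -(big_morph _ (@uembD R A) (erefl _)) -smulZl -smulZr -uembZ -/h.
  have -> : uemb h = e - w by rewrite /w subKr.
  rewrite -smulA (pw_comm el er); first by rewrite /g (pwD el) smulA.
  by rewrite smulBl [RHS]smulBr el er.
have gp : pos e (unorm (@nrm R A)) g.
  by rewrite -gE; apply: posZ => //; [exact: ltW|apply: pos_sum].
have gn : unorm (@nrm R A) g <= (n + n)%:R^-1.
  apply: (pos_le el er NU) => //; first by rewrite invr_ge0.
  have := pos_telescope el er NU (n + n) wp; rewrite -/g.
  have nn0 : 0 < (n + n)%:R :> R by rewrite natrD addr_gt0.
  move/(posZ NU (t := (n + n)%:R^-1)); rewrite invr_ge0 ltW // => /(_ isT).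
  rewrite scalerBr -(scaler_nat _ g) scalerA -(rmorph_nat (real_complex R)) -rmorphM.
  by rewrite mulVf ?gt_eqF // rmorph1 scale1r.
have : unorm (@nrm R A) (F x) <= unorm (@nrm R A) (\sum_(z <- s) F z).
  rewrite (big_rem x) //=; apply: (pos_monotone el er NU) => //.
  by apply: pos_sum.
move/le_trans; apply.
have -> : \sum_(z <- s) F z = t^-1%:C *: g.
  by rewrite -gE scalerA -rmorphM mulVf ?gt_eqF // rmorph1 scale1r.
rewrite (snormr (semiZ NU)) ger0_norm; last by rewrite invr_ge0 ltW.
apply: le_trans (ler_wpM2l _ gn) _; first by rewrite invr_ge0 ltW.
have d20 : 0 < d ^+ 2 by rewrite exprn_gt0.
rewrite ler_pdivrMr; last by rewrite natrD addr_gt0.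
rewrite -ler_pdivrMl // mulrC.
apply: ltW; apply: lt_le_trans Hm _.
have : m%:R <= n%:R :> R by rewrite ler_nat ltnW.
rewrite natrD; lra.
Qed.

End Bimodule.

(** * Tensor products *)

Section Functional.
Variables (K : fieldType) (V : lmodType K).
Local Open Scope classical_set_scope.

(** A maximal subspace avoiding [v] is a complement of the line through [v]; the functional reads
    off the coefficient of [v]. *)
Lemma exists_functional (v : V) : v != 0 -> exists f : V -> K,
  [/\ forall x y, f (x + y) = f x + f y, forall z x, f (z *: x) = z * f x & f v = 1].
Proof.
move=> v0.
pose P (S : set V) := [/\ forall x y, S x -> S y -> S (x + y),
  forall z x, S x -> S (z *: x) & ~ S v].
have [F FP Ftot|S [[SD SZ Sv] Smax]] := @Zorn_bigcup V P.
  split=> [x y [S1 F1 x1] [S2 F2 y2]|z x [S1 F1 x1]|[S1 F1 v1]].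
  - have [S12|S21] := Ftot _ _ F1 F2.
      by exists S2 => //; have [D _ _] := FP _ F2; apply: D => //; apply: S12.
    by exists S1 => //; have [D _ _] := FP _ F1; apply: D => //; apply: S21.
  - by exists S1 => //; have [_ Z _] := FP _ F1; apply: Z.
  - by have [_ _ N] := FP _ F1; apply: N.
(* The empty set satisfies [P], so even 0 in [S] has to come from maximality. *)
have S0 : S 0.
  apply: contrapT => nS0; apply: (Smax [set 0]).
    split=> [x Sx|H]; first by case: nS0; rewrite -(scale0r x); exact: SZ.
    by apply: nS0; apply: H.
  split=> [x y -> ->|z x ->|/= v00]; rewrite ?addr0 ?scaler0 //.
  by rewrite v00 eqxx in v0.
have Sex u : exists z, S (u - z *: v).
  have [Su|nSu] := pselect (S u); first by exists 0; rewrite scale0r subr0.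
  pose S' := [set w | exists c, S (w - c *: u)].
  have : ~ P S'.
    apply: Smax; split=> [x Sx|H]; first by exists 0; rewrite scale0r subr0.
    by apply: nSu; apply: H; exists 1; rewrite scale1r subrr.
  have [[c Sc] _|nS'v []] := pselect (S' v); last first.
    split=> // [x y [c Sx] [d Sy]|z x [c Sx]].
      by exists (c + d); have := SD _ _ Sx Sy; congr S; rewrite scalerDl; zmod.
    by exists (z * c); have := SZ z _ Sx; congr S; rewrite scalerBr scalerA.
  have c0 : c != 0.
    by apply/eqP => c0; apply: Sv; move: Sc; rewrite c0 scale0r subr0.
  exists c^-1; have := SZ (- c^-1) _ Sc; congr S.
  by rewrite scalerBr !scaleNr scalerA mulVf // scale1r; zmod.
have [f fS] := choice Sex.
have uniq_f u z : S (u - z *: v) -> f u = z.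
  move=> Sz; apply/eqP/contraT => fz; case: Sv.
  have Sd : S ((f u - z) *: v).
    have := SD _ _ Sz (SZ (-1) _ (fS u)); congr S.
    by rewrite scaleN1r scalerBl; zmod.
  by have := SZ (f u - z)^-1 _ Sd; rewrite scalerA mulVf ?scale1r // subr_eq0.
exists f; split=> [x y|z x|].
- by apply: uniq_f; have := SD _ _ (fS x) (fS y); congr S; rewrite scalerDl; zmod.
- by apply: uniq_f; have := SZ z _ (fS x); congr S; rewrite scalerBr scalerA.
- by apply: uniq_f; rewrite scale1r subrr.
Qed.

End Functional.

Section TensorMaps.
Variable K : comNzRingType.

(** In the uses [s] and [t] are the identity or complex conjugation, so that actions and both inner
    products extend to tensor products by one construction. *)
Record bimap (A B Z : lmodType K) (s t : K -> K) (f : A -> B -> Z) : Prop := {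
  bimapDl : forall a a' b, f (a + a') b = f a b + f a' b;
  bimapDr : forall a b b', f a (b + b') = f a b + f a b';
  bimapZl : forall z a b, f (z *: a) b = s z *: f a b;
  bimapZr : forall z a b, f a (z *: b) = t z *: f a b
}.

Definition tbil (A C B D Z F : lmodType K) (f : A -> B -> Z) (g : C -> D -> F)
    (x : tensor A C) (y : tensor B D) : tensor Z F :=
  tlift (fun a c => tlift (fun b d => tpure (f a b) (g c d)) y) x.

Variables (A C B D Z F : lmodType K) (s t : K -> K).
Variables (f : A -> B -> Z) (g : C -> D -> F).
Hypotheses (Hf : bimap s t f) (Hg : bimap s t g).
Local Notation h := (tbil f g).

Let bal_in a c : balanced (fun b d => tpure (f a b) (g c d)).
Proof.
split=> [b b' d|b d d'|z b d].
- by rewrite (bimapDr Hf) tpureDl.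
- by rewrite (bimapDr Hg) tpureDr.
- by rewrite (bimapZr Hf) (bimapZr Hg) tpureZ.
Qed.

Let bal_out y : balanced (fun a c => tlift (fun b d => tpure (f a b) (g c d)) y).
Proof.
split=> [a a' c|a c c'|z a c]; elim/tensor_ind: y => [|u v eu ev|b d];
  rewrite ?(tlift0 (bal_in _ _)) ?addr0 // ?(tliftD (bal_in _ _)) ?eu ?ev
    ?(tlift_pure (bal_in _ _)) //; try zmod.
- by rewrite (bimapDl Hf) tpureDl.
- by rewrite (bimapDl Hg) tpureDr.
- by rewrite (bimapZl Hf) (bimapZl Hg) tpureZ.
Qed.

Lemma tbilE a c b d : h (tpure a c) (tpure b d) = tpure (f a b) (g c d).
Proof. by rewrite /tbil (tlift_pure (bal_out _)) (tlift_pure (bal_in _ _)). Qed.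

Lemma tbilDl x x' y : h (x + x') y = h x y + h x' y.
Proof. exact: (tliftD (bal_out y)). Qed.

Lemma tbil0l y : h 0 y = 0.
Proof. exact: (tlift0 (bal_out y)). Qed.

Lemma tbil_purel a c y :
  h (tpure a c) y = tlift (fun b d => tpure (f a b) (g c d)) y.
Proof. exact: (tlift_pure (bal_out y)). Qed.

Lemma tbil0r x : h x 0 = 0.
Proof.
elim/tensor_ind: x => [|u v eu ev|a c]; first exact: tbil0l.
  by rewrite tbilDl eu ev addr0.
by rewrite tbil_purel (tlift0 (bal_in a c)).
Qed.

Lemma tbilDr x y y' : h x (y + y') = h x y + h x y'.
Proof.
elim/tensor_ind: x => [|u v eu ev|a c]; first by rewrite !tbil0l addr0.
  by rewrite !tbilDl eu ev; zmod.
by rewrite !tbil_purel (tliftD (bal_in a c)).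
Qed.

Lemma tbilZr z x y : h x (z *: y) = t z *: h x y.
Proof.
elim/tensor_ind: x => [|u v eu ev|a c]; first by rewrite !tbil0l scaler0.
  by rewrite !tbilDl eu ev scalerDr.
elim/tensor_ind: y => [|u v eu ev|b d]; first by rewrite scaler0 tbil0r scaler0.
  by rewrite scalerDr !tbilDr eu ev scalerDr.
by rewrite -tpureZl !tbilE (bimapZr Hf) tpureZl.
Qed.

Lemma tbilZl z x y : h (z *: x) y = s z *: h x y.
Proof.
elim/tensor_ind: x => [|u v eu ev|a c]; first by rewrite scaler0 !tbil0l scaler0.
  by rewrite scalerDr !tbilDl eu ev scalerDr.
elim/tensor_ind: y => [|u v eu ev|b d]; first by rewrite !tbil0r scaler0.
  by rewrite !tbilDr eu ev scalerDr.
by rewrite -tpureZl !tbilE (bimapZl Hf) tpureZl.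
Qed.

End TensorMaps.

Section LinearMaps.
Variables (K : fieldType) (A C : lmodType K).

Definition linmap (M N : lmodType K) (f : M -> N) :=
  (forall x y, f (x + y) = f x + f y) /\ (forall z x, f (z *: x) = z *: f x).

Lemma linmap0 (M N : lmodType K) (f : M -> N) : linmap f -> f 0 = 0.
Proof. by case=> _ fZ; rewrite -(scale0r 0) fZ scale0r. Qed.

Lemma linmap_sum (M N : lmodType K) (f : M -> N) I (s : seq I) (G : I -> M) :
  linmap f -> f (\sum_(i <- s) G i) = \sum_(i <- s) f (G i).
Proof. by move=> fl; apply: big_morph; [exact: fl.1|exact: linmap0]. Qed.

Lemma tpure0l (c : C) : tpure 0 c = 0 :> tensor A C.
Proof. by rewrite -(scale0r 0) tpureZl scale0r. Qed.

Lemma tpureBl (a b : A) (c : C) : tpure (a - b) c = tpure a c - tpure b c.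
Proof. by rewrite tpureDl -(scaleN1r b) tpureZl scaleN1r. Qed.

Lemma tpure_linr (a : A) : linmap (@tpure K A C a).
Proof. by split=> [x y|z x]; [exact: tpureDr|exact: tpureZr]. Qed.

End LinearMaps.

(** * Separating families of maps on a tensor product *)

Section TensorInjective.
Variables (K : fieldType) (A C V W : lmodType K).

(** When c depends linearly on the other second factors, its term a (x) c is absorbed into their
    first factors and the sum gets shorter. The maps f and g let one statement serve both the
    relations and the conclusion of [tensor_eq0]. *)
Lemma tensor_shift (V' W' : lmodType K) (f : A -> V') (g : C -> W') a c
    (z : A * C -> K) (s : seq (A * C)) : linmap f -> linmap g ->
  c = - \sum_(p <- s) z p *: p.2 ->
  \sum_(p <- [seq (p.1 - z p *: a, p.2) | p <- s]) tpure (f p.1) (g p.2) =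
  tpure (f a) (g c) + \sum_(p <- s) tpure (f p.1) (g p.2).
Proof.
move=> fl gl ->; rewrite big_map /= -sumrN (linmap_sum _ _ gl).
rewrite (linmap_sum _ _ (tpure_linr _ _)) -big_split /=; apply: eq_bigr => p _.
rewrite -!scaleNr fl.1 fl.2 gl.2 tpureDl tpureZl tpureZr addrC.
by [].
Qed.

(** Induction on the length replaces bases. If some [f i a] is nonzero, a functional with value 1
    there, applied to the relations, shows that every [g j] kills c + sum_p z_p c_p; hence c depends
    on the other second factors and [tensor_shift] applies. *)
Lemma tensor_eq0 (I J : Type) (f : I -> A -> V) (g : J -> C -> W) (s : seq (A * C)) :
  (forall i, linmap (f i)) -> (forall j, linmap (g j)) ->
  (forall a, (forall i, f i a = 0) -> a = 0) ->
  (forall c, (forall j, g j c = 0) -> c = 0) ->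
  (forall i j, \sum_(p <- s) tpure (f i p.1) (g j p.2) = 0) ->
  \sum_(p <- s) tpure p.1 p.2 = 0.
Proof.
move=> fl gl f0 g0; elim: {s}(size s) {-2}s (erefl (size s)) => [|n IH] [|[a c] s] //.
  by move=> _ _; rewrite big_nil.
move=> [sn] H; have [fa|/existsNP[i fia]] := pselect (forall i, f i a = 0).
  rewrite big_cons /= (f0 a fa) tpure0l add0r; apply: IH => // i j.
  by have := H i j; rewrite big_cons /= fa tpure0l add0r.
have [k [kD kZ ka]] := exists_functional (introN eqP fia).
have kb : balanced (fun v w => k v *: w : W).
  split=> [v v' w|v w w'|z v w]; first by rewrite kD scalerDl.
    by rewrite scalerDr.
  by rewrite kZ scalerA mulrC.
have cE : c = - \sum_(p <- s) k (f i p.1) *: p.2.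
  apply/eqP; rewrite -addr_eq0; apply/eqP/g0 => j.
  have := congr1 (tlift (fun v w => k v *: w : W)) (H i j).
  rewrite (tlift0 kb) (big_morph _ (tliftD kb) (tlift0 kb)) big_cons /=.
  rewrite (tlift_pure kb) ka scale1r (gl j).1 (linmap_sum _ _ (gl j)) => E.
  rewrite -[RHS]E; congr (_ + _); apply: eq_bigr => p _.
  by rewrite (tlift_pure kb) (gl j).2.
pose z (p : A * C) := k (f i p.1).
have id_lin (M : lmodType K) : linmap (@id M) by [].
have := @tensor_shift _ _ id id a c z s (id_lin A) (id_lin C) cE.
rewrite big_cons /= => <-; apply: IH; first by rewrite size_map.
by move=> i' j; have := H i' j;
  rewrite (@tensor_shift _ _ _ _ a c z s (fl i') (gl j) cE) big_cons.
Qed.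

End TensorInjective.

Section TensorMap.
Variables (K : fieldType) (A C A' C' : lmodType K) (f : A -> A') (g : C -> C').
Hypotheses (fl : linmap f) (gl : linmap g).

Definition tmap : tensor A C -> tensor A' C' := tlift (fun a c => tpure (f a) (g c)).

Let tmap_balanced : balanced (fun a c => tpure (f a) (g c)).
Proof.
split=> [a a' c|a c c'|z a c]; first by rewrite fl.1 tpureDl.
  by rewrite gl.1 tpureDr.
by rewrite fl.2 gl.2 tpureZ.
Qed.

Lemma tmapE a c : tmap (tpure a c) = tpure (f a) (g c).
Proof. exact: (tlift_pure tmap_balanced). Qed.
Lemma tmapD x y : tmap (x + y) = tmap x + tmap y.
Proof. exact: (tliftD tmap_balanced). Qed.
Lemma tmap0 : tmap 0 = 0.
Proof. exact: (tlift0 tmap_balanced). Qed.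
End TensorMap.

Lemma linmap_id (K : fieldType) (M : lmodType K) : linmap (@id M).
Proof. by []. Qed.

(** * The inner product on M (x) C, for M a bimodule or an algebra *)

Section TensorHilbert.
Variables (R : realType) (B C D : starAlgType R) (M : lmodType R[i]).
Variables (r0 : M -> M -> B) (lam : D -> M -> M).
Hypothesis r0b : bimap (fun z : R[i] => z^*) (fun z => z) r0.
Hypothesis lamb : bimap (fun z : R[i] => z) (fun z => z) lam.
Hypothesis lamM : forall a b x, lam (a ** b) x = lam a (lam b x).
Hypothesis lam_adj : forall a x y, r0 (lam a x) y = r0 x (lam (star a) y).

Definition starmul (c d : C) := star c ** d.

Lemma starmul_bimap : bimap (fun z : R[i] => z^*) (fun z => z) starmul.
Proof.
split=> *; rewrite /starmul.
- by rewrite starD smulDl.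
- by rewrite smulDr.
- by rewrite starZ smulZl.
- by rewrite smulZr.
Qed.

Definition tip : tensor M C -> tensor M C -> tensor B C := tbil r0 starmul.

Let cb := starmul_bimap.
Let E := tensor M C.
Implicit Types x y : E.

Lemma lam_lin a : linmap (lam a).
Proof. by split=> [x y|z x]; rewrite ?(bimapDr lamb) ?(bimapZr lamb). Qed.

Lemma smul_lin (c : C) : linmap (smul c).
Proof. by split=> [x y|z x]; rewrite ?smulDr ?smulZr. Qed.

Definition tactl (a : D) : E -> E := tmap (lam a) id.
Definition tactr (c : C) : E -> E := tmap id (smul c).

Let cl := @linmap_id R[i] C.
Let ml := @linmap_id R[i] M.

Lemma tactl0 a : tactl a 0 = 0.
Proof. exact: (tmap0 (lam_lin a) cl). Qed.
Lemma tactlDr a x y : tactl a (x + y) = tactl a x + tactl a y.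
Proof. exact: (tmapD (lam_lin a) cl). Qed.
Lemma tactlE a m c : tactl a (tpure m c) = tpure (lam a m) c.
Proof. exact: (tmapE (lam_lin a) cl). Qed.
Lemma tactr0 a : tactr a 0 = 0.
Proof. exact: (tmap0 ml (smul_lin a)). Qed.
Lemma tactrDr a x y : tactr a (x + y) = tactr a x + tactr a y.
Proof. exact: (tmapD ml (smul_lin a)). Qed.
Lemma tactrE a m c : tactr a (tpure m c) = tpure m (a ** c).
Proof. exact: (tmapE ml (smul_lin a)). Qed.

Lemma tactlDl a b x : tactl (a + b) x = tactl a x + tactl b x.
Proof.
elim/tensor_ind: x => [|u v eu ev|m c]; first by rewrite !tactl0 addr0.
  by rewrite !tactlDr eu ev; zmod.
by rewrite !tactlE (bimapDl lamb) tpureDl.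
Qed.
Lemma tactlZl (z : R[i]) a x : tactl (z *: a) x = z *: tactl a x.
Proof.
elim/tensor_ind: x => [|u v eu ev|m c]; first by rewrite !tactl0 scaler0.
  by rewrite !tactlDr eu ev scalerDr.
by rewrite !tactlE (bimapZl lamb) tpureZl.
Qed.
Lemma tactlM a b x : tactl (a ** b) x = tactl a (tactl b x).
Proof.
elim/tensor_ind: x => [|u v eu ev|m c]; first by rewrite !tactl0.
  by rewrite !tactlDr eu ev.
by rewrite !tactlE lamM.
Qed.
Lemma tactrDl a b x : tactr (a + b) x = tactr a x + tactr b x.
Proof.
elim/tensor_ind: x => [|u v eu ev|m c]; first by rewrite !tactr0 addr0.
  by rewrite !tactrDr eu ev; zmod.
by rewrite !tactrE smulDl tpureDr.
Qed.
Lemma tactrZl (z : R[i]) a x : tactr (z *: a) x = z *: tactr a x.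
Proof.
elim/tensor_ind: x => [|u v eu ev|m c]; first by rewrite !tactr0 scaler0.
  by rewrite !tactrDr eu ev scalerDr.
by rewrite !tactrE smulZl tpureZr.
Qed.
Lemma tactrM a b x : tactr (a ** b) x = tactr a (tactr b x).
Proof.
elim/tensor_ind: x => [|u v eu ev|m c]; first by rewrite !tactr0.
  by rewrite !tactrDr eu ev.
by rewrite !tactrE smulA.
Qed.

Lemma tipE m c n d : tip (tpure m c) (tpure n d) = tpure (r0 m n) (star c ** d).
Proof. exact: (tbilE r0b cb). Qed.
Lemma tipDl x y z : tip (x + y) z = tip x z + tip y z.
Proof. exact: (tbilDl r0b cb). Qed.
Lemma tipDr x y z : tip x (y + z) = tip x y + tip x z.
Proof. exact: (tbilDr r0b cb). Qed.
Lemma tip0l y : tip 0 y = 0.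
Proof. exact: (tbil0l r0b cb). Qed.
Lemma tip0r y : tip y 0 = 0.
Proof. exact: (tbil0r r0b cb). Qed.
Lemma tipZr (z : R[i]) x y : tip x (z *: y) = z *: tip x y.
Proof. exact: (tbilZr r0b cb). Qed.

Lemma tip_star x y : (forall m n, star (r0 m n) = r0 n m) -> star (tip x y) = tip y x.
Proof.
move=> r0S; elim/tensor_ind: x => [|u v eu ev|m c]; first by rewrite tip0l tip0r star0.
  by rewrite tipDl tipDr starD eu ev.
elim/tensor_ind: y => [|u v eu ev|n d]; first by rewrite tip0l tip0r star0.
  by rewrite tipDl tipDr starD eu ev.
by rewrite !tipE [LHS]tstarE r0S starM starK.
Qed.

Lemma tactl_adj a x y : tip (tactl a x) y = tip x (tactl (star a) y).
Proof.
elim/tensor_ind: x => [|u v eu ev|m c]; first by rewrite tactl0 !tip0l.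
  by rewrite tactlDr !tipDl eu ev.
elim/tensor_ind: y => [|u v eu ev|n d]; first by rewrite tactl0 !tip0r.
  by rewrite tactlDr !tipDr eu ev.
by rewrite !tactlE !tipE lam_adj.
Qed.

Lemma tactr_adj a x y : tip (tactr a x) y = tip x (tactr (star a) y).
Proof.
elim/tensor_ind: x => [|u v eu ev|m c]; first by rewrite tactr0 !tip0l.
  by rewrite tactrDr !tipDl eu ev.
elim/tensor_ind: y => [|u v eu ev|n d]; first by rewrite tactr0 !tip0r.
  by rewrite tactrDr !tipDr eu ev.
by rewrite !tactrE !tipE starM smulA.
Qed.

End TensorHilbert.

(** * C*-seminorms on B (x) C are bounded on pure tensors *)

Section CrossNorm.
Variables (R : realType) (B C : cstarAlgType R) (q : tensor B C -> R).
Hypothesis Hq : cstar_semi q.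
Let T := tensor B C.

Let starmul_bal := @starmul_bimap R B.
Let sb : bimap (fun z : R[i] => z) (fun z => z) (@smul R B).
Proof.
by split=> *; rewrite ?smulDl ?smulDr ?smulZl ?smulZr.
Qed.

Lemma tip_smul (s t : T) : tip (@starmul R B) s t = star s ** t.
Proof.
elim/tensor_ind: s => [|u v eu ev|m c]; first by rewrite tip0l // star0 smul0l.
  by rewrite tipDl // starD smulDl eu ev.
elim/tensor_ind: t => [|u v eu ev|n d]; first by rewrite tip0r // smul0r.
  by rewrite tipDr // smulDr eu ev.
by rewrite tipE // -[RHS]/(tmul (tstar _) _) tstarE tmulE.
Qed.

Let Hr : inner_product q (tip (@starmul R B) (C := C)).
Proof.
split=> [x y z|z x y|x y|x].
- exact: tipDr.
- exact: tipZr.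
- by rewrite !tip_smul starM starK.
- by rewrite tip_smul; exact: spos_star.
Qed.

(** Multiplication by one factor need not be by an element of B (x) C, but it is an operator,
    adjointable for the inner product s^*t and so contractive by [ipn_contract]. For a pure tensor
    x, the element x^*x is x moved by two such operators. *)
Lemma cross_norm b c : q (tpure b c) <= nrm b * nrm c.
Proof.
have ipnE t : ipn q (tip (@starmul R B) (C := C)) t = q t.
  by rewrite /ipn tip_smul (semiE Hq) sqrtr_sqr ger0_norm // (semi_ge0 Hq).
have [->|n0] := eqVneq (q (tpure b c)) 0.
  by rewrite mulr_ge0 // (semi_ge0 (@nrm_semi _ _)).
have q0 : 0 < q (tpure b c) by rewrite lt_def n0 (semi_ge0 Hq).
rewrite -(ler_pM2r q0) -expr2 -(semiE Hq).
have -> : star (tpure b c) ** tpure b c =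
    tactl (@smul R B) (star b) (tactr (star c) (tpure b c : T)).
  rewrite tactrE (tactlE sb) -[LHS]/(tmul (tstar _) _) tstarE tmulE.
  by [].
rewrite -!ipnE -(semi_star (@nrm_semi R B)) -(semi_star (@nrm_semi R C)).
apply: (@le_trans _ _ (nrm (star b) *
  ipn q (tip (@starmul R B) (C := C)) (tactr (star c) (tpure b c)))).
  apply: (ipn_contract Hq Hr); [exact: tactlDl|exact: tactlZl|..].
    exact: (tactlM sb (fun a b x => esym (smulA a b x))).
  by move=> a x y; apply: tactl_adj => // u v w; rewrite /starmul starM smulA.
rewrite -mulrA ler_wpM2l ?(semi_ge0 (@nrm_semi _ _)) //.
apply: (ipn_contract Hq Hr); [exact: tactrDl|exact: tactrZl|exact: tactrM|].
by move=> a x y; apply: tactr_adj.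
Qed.

End CrossNorm.

Section GeometricSum.
Variables (R : realType) (T : starAlgType R) (q : T -> R) (E : zmodType).
Variables (r : E -> E -> T) (H : E -> E).
Hypothesis Hq : cstar_semi q.
Hypothesis rDl : forall x y z, r (x + y) z = r x z + r y z.
Hypothesis rDr : forall x y z, r x (y + z) = r x y + r x z.
Hypothesis HD : forall x y, H (x + y) = H x + H y.
Hypothesis H_adj : forall x y, r (H x) y = r x (H y).
Hypothesis H_pos : forall x, spos q (r x (H x)).

Let W x := x - H x.

(* With w = 1 - h one has 1 - w^(2m+1) = h (1 + ... + w^2m), and
   2 (1 + ... + w^2m) = 1 + w^2m + sum_(j < m) (w^j + w^(j+1))^2. *)
Lemma spos_geometric m x : spos q (r x (x - iter m.*2.+1 W x)).
Proof.
have rNr y z : r y (- z) = - r y z.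
  by apply: (addrI (r y z)); rewrite -rDr !subrr; apply: (addrI (r y 0)); rewrite -rDr !addr0.
have HN y : H (- y) = - H y.
  by apply: (addrI (H y)); rewrite -HD !subrr; apply: (addrI (H 0)); rewrite -HD !addr0.
have rNl y z : r (- y) z = - r y z.
  by apply: (addrI (r y z)); rewrite -rDl !subrr; apply: (addrI (r 0 z)); rewrite -rDl !addr0.
have W_adj y z : r (W y) z = r y (W z).
  by rewrite /W rDl rDr rNl rNr H_adj.
have Wn_adj n y z : r (iter n W y) z = r y (iter n W z).
  by elim: n z => // n IH z; rewrite iterS W_adj IH -iterSr.
have HW y : H (W y) = W (H y) by rewrite /W HD HN.
have HWn n y : H (iter n W y) = iter n W (H y) by elim: n => //= n IH; rewrite HW IH.
(* Twice the target without the end term <W^n x, H W^n x>; passing to n + 1 then adds exactly the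
   positive term of W^n x + W^(n+1) x. *)
pose Q n := r x (x - iter n.*2.+1 W x) *+ 2 - r (iter n W x) (H (iter n W x)).
suff Qp n : spos q (Q n).
  have := sposZ Hq (t := 2^-1) (ltac:(by rewrite invr_ge0))
    (sposD Hq (Qp m) (H_pos (iter m W x))).
  by rewrite subrK mulr2n half_dbl.
elim: n => [|n IH].
  rewrite /Q /= /W subKr mulr2n addrK; exact: H_pos.
have -> : Q n.+1 = Q n + r (iter n W x + iter n.+1 W x) (H (iter n W x + iter n.+1 W x)).
  have ab : r (iter n.+1 W x) (H (iter n W x)) = r (iter n W x) (H (iter n.+1 W x)).
    by rewrite iterS W_adj -HW.
  have e2 : iter n.+1.*2.+1 W x =
    iter n.*2.+1 W x - H (iter n.*2.+1 W x) - H (iter n.*2.+2 W x) by [].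
  have f0 : r x (H (iter n.*2.+1 W x)) = r (iter n W x) (H (iter n.+1 W x)).
    by rewrite [RHS]Wn_adj !HWn -iterD addnS addnn.
  have f1 : r x (H (iter n.*2.+2 W x)) = r (iter n.+1 W x) (H (iter n.+1 W x)).
    by rewrite [RHS]Wn_adj !HWn -iterD addnS addSn addnn.
  rewrite /Q e2; move: ab f0 f1 {e2}; move: (iter n.*2.+1 W x) (iter n.*2.+2 W x).
  move: (iter n W x) (iter n.+1 W x) => a b c0 c1 ab f0 f1.
  rewrite !HD !rDl !rDr !rNr !rDr !rNr f0 f1 ab; zmod.
exact: sposD.
Qed.

End GeometricSum.

(** * The induced norm *)

Section Induced.
Variables (R : realType) (A B C : cstarAlgType R) (X : imprimitivity_bimodule A B).
Local Notation la := (ib_lact (i := X)).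
Local Notation ra := (ib_ract (i := X)).
Local Notation l := (ib_lip (i := X)).
Local Notation r := (ib_rip (i := X)).
Let HL := ib_left X.
Let HR := ib_right X.
Let NA := @nrm_semi R A.
Let NB := @nrm_semi R B.
Let NC := @nrm_semi R C.
Let HX := rip_inner_product X.
Local Notation E := (tensor X C).
Local Notation TA := (tensor A C).
Local Notation TB := (tensor B C).
Local Notation cid := (fun z : R[i] => z).
Local Notation cconj := (fun z : R[i] => z^*).

Let la_bimap : bimap cid cid la.
Proof.
split; [exact: lactDl HL|exact: lactDr HL|exact: lactZl HL|exact: lactZr HL].
Qed.
Let ra_bimap : bimap cid cid ra.
Proof.
by split=> *; rewrite ?(ractDl HR) ?(ractDr HR) ?(ractZl HR) ?(ractZr HR).
Qed.
Let smul_bimap (D : starAlgType R) : bimap cid cid (@smul R D).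
Proof. by split=> *; rewrite ?smulDl ?smulDr ?smulZl ?smulZr. Qed.
Let mulstar (c d : C) := c ** star d.
Let mulstar_bimap : bimap cid cconj mulstar.
Proof.
split=> *; rewrite /mulstar.
- by rewrite smulDl.
- by rewrite starD smulDr.
- by rewrite smulZl.
- by rewrite starZ smulZr.
Qed.
Let l_bimap : bimap cid cconj l.
Proof.
split; [exact: lipDl HL|exact: lipDr|exact: lipZl HL|].
by move=> *; exact: lipZr.
Qed.
Let r_bimap : bimap cconj cid r.
Proof.
split; [exact: (ipDl HX)|exact: ripDr HR|exact: (ipZl HX)|exact: ripZr HR].
Qed.

Definition tlact : TA -> E -> E := tbil la (@smul R C).
Definition tract : E -> TB -> E := tbil ra (@smul R C).
Definition tlip : E -> E -> TA := tbil l mulstar.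
Definition trip : E -> E -> TB := tip r.

Let sC := smul_bimap C.

Let tE := (tbilE la_bimap sC, tbilE ra_bimap sC, tbilE l_bimap mulstar_bimap,
  tipE (C := C) r_bimap).
Let tD := (tbilDl la_bimap sC, tbilDl ra_bimap sC, tbilDl l_bimap mulstar_bimap,
  tbilDr la_bimap sC, tbilDr ra_bimap sC, tbilDr l_bimap mulstar_bimap,
  tipDl (C := C) r_bimap, tipDr (C := C) r_bimap, @starD R TA, @starD R TB,
  @smulDl R TA, @smulDr R TA, @smulDl R TB, @smulDr R TB).
Let t0 := (tbil0l la_bimap sC, tbil0l ra_bimap sC, tbil0l l_bimap mulstar_bimap,
  tbil0r la_bimap sC, tbil0r ra_bimap sC, tbil0r l_bimap mulstar_bimap,
  tip0l (C := C) r_bimap, tip0r (C := C) r_bimap, @star0 R TA, @star0 R TB,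
  @smul0l R TA, @smul0r R TA, @smul0l R TB, @smul0r R TB).

Let tsmulE (D : starAlgType R) (a a' : D) (c c' : C) :
  (tpure a c : tensor D C) ** tpure a' c' = tpure (a ** a') (c ** c').
Proof. exact: tmulE. Qed.
Let tsE (D : starAlgType R) (a : D) (c : C) :
  star (tpure a c : tensor D C) = tpure (star a) (star c).
Proof. exact: tstarE. Qed.

Lemma tlactM s t x : tlact (s ** t) x = tlact s (tlact t x).
Proof.
rewrite /tlact; elim/tensor_ind: s => [|u v eu ev|a c]; first by rewrite !t0.
  by rewrite !tD eu ev.
elim/tensor_ind: t => [|u v eu ev|a' c']; first by rewrite !t0.
  by rewrite !tD eu ev.
elim/tensor_ind: x => [|u v eu ev|x d]; first by rewrite !t0.
  by rewrite !tD eu ev.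
by rewrite tsmulE !tE (lact_A HL) smulA.
Qed.

Lemma trip_tract x y t : trip x (tract y t) = trip x y ** t.
Proof.
rewrite /trip /tract; elim/tensor_ind: x => [|u v eu ev|x c]; first by rewrite !t0.
  by rewrite !tD eu ev.
elim/tensor_ind: y => [|u v eu ev|y d]; first by rewrite !t0.
  by rewrite !tD eu ev.
elim/tensor_ind: t => [|u v eu ev|b c']; first by rewrite !t0.
  by rewrite !tD eu ev.
by rewrite !tE tsmulE (rip_act HR) smulA.
Qed.

Lemma tlact_adj t x y : trip (tlact t x) y = trip x (tlact (star t) y).
Proof.
rewrite /trip /tlact; elim/tensor_ind: t => [|u v eu ev|a c']; first by rewrite !t0.
  by rewrite !tD eu ev.
elim/tensor_ind: x => [|u v eu ev|x c]; first by rewrite !t0.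
  by rewrite !tD eu ev.
elim/tensor_ind: y => [|u v eu ev|y d]; first by rewrite !t0.
  by rewrite !tD eu ev.
by rewrite tsE !tE rip_lact_adj starM smulA.
Qed.

Lemma tcompat x y z : tlact (tlip x y) z = tract x (trip y z).
Proof.
rewrite /tlact /tlip /tract /trip.
elim/tensor_ind: x => [|u v eu ev|x c]; first by rewrite !t0.
  by rewrite !tD eu ev.
elim/tensor_ind: y => [|u v eu ev|y c']; first by rewrite !t0.
  by rewrite !tD eu ev.
elim/tensor_ind: z => [|u v eu ev|z d]; first by rewrite !t0.
  by rewrite !tD eu ev.
by rewrite !tE ib_compat smulA.
Qed.

Lemma tlip_star x y : star (tlip x y) = tlip y x.
Proof.
rewrite /tlip; elim/tensor_ind: x => [|u v eu ev|x c]; first by rewrite !t0.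
  by rewrite !tD eu ev.
elim/tensor_ind: y => [|u v eu ev|y c']; first by rewrite !t0.
  by rewrite !tD eu ev.
by rewrite !tE tsE (lip_star HL) /mulstar starM starK.
Qed.

Lemma trip_star x y : star (trip x y) = trip y x.
Proof. by apply: (tip_star r_bimap); exact: rip_star HR. Qed.

(** The source of all positivity of [trip]: for y = z the right side has the form s^*s. *)
Lemma trip_lip_pos x y z : trip y (tactl la (l x x) z) =
  star (tmap (r x) id y) ** tmap (r x) (@id C) z.
Proof.
have rl : linmap (r x) by split=> *; rewrite ?(ripDr HR) ?(ripZr HR).
have cl := @linmap_id R[i] C.
rewrite /trip; elim/tensor_ind: y => [|u v eu ev|y c]; first by rewrite (tmap0 rl cl) !t0.
  by rewrite (tmapD rl cl) !tD eu ev.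
elim/tensor_ind: z => [|u v eu ev|z d].
- by rewrite (tmap0 rl cl) (tactl0 C la_bimap) !t0.
- by rewrite (tmapD rl cl) (tactlDr la_bimap) !tD eu ev.
rewrite (tactlE la_bimap) tE !(tmapE rl cl) tsE tsmulE.
by rewrite ib_compat (rip_act HR) (rip_star HR).
Qed.

(** * Transport of a seminorm from B (x) C to A (x) C *)

Section FromB.
Variable q : TB -> R.
Hypothesis Hq : cstar_semi q.

Let q0 := semi_ge0 Hq.
Let qD := semiD Hq.
Let qZ := semiZ Hq.

(** Smallness of (1 - h)^n x_j is known in X only; [cross_norm] carries it over to [q], one summand
    <x_i, (1 - h)^n x_j> (x) c_i^* c_j at a time. The exponent is odd to suit [spos_geometric]. *)
Lemma trip_spos x : spos q (trip x x).
Proof.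
apply: (spos_lim Hq) => [|d d0]; first exact: trip_star.
rewrite (tensor_sum x); move: (repr x) => s {x}.
set x := \sum_(p <- s) _.
(* [M] collects the factors 4 |x_i| of [ip_CS] and |c_i^* c_j| over all pairs, so remainders of size
   d / (M + 1) add up to at most [d]. *)
pose M := \sum_(p <- s) \sum_(p' <- s) 4 * ipn (@nrm R B) r p.1 * nrm (star p.2 ** p'.2).
have M0 : 0 <= M.
  apply: sumr_ge0 => p _; apply: sumr_ge0 => p' _.
  by rewrite !mulr_ge0 // ?ipn_ge0 // (semi_ge0 NC).
have M1 : 0 < M + 1 by lra.
have [t [m [tp Ht]]] := approx_unit [seq p.1 | p <- s] (divr_gt0 d0 M1).
set h := t%:C *: _ in Ht.
pose H := tactl la h : E -> E.
pose W y := y - H y.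
exists (trip x (x - iter m.*2.+1 W x)).
  apply: (spos_geometric Hq (r := trip) (H := H)).
  - exact: tipDl.
  - exact: tipDr.
  - exact: (tactlDr la_bimap).
  - move=> y z; rewrite /H /trip (tactl_adj r_bimap la_bimap) //; last exact: rip_lact_adj.
    congr (tip _ _ (tactl _ _ _)); rewrite /h starZr star_sum; congr (_ *: _).
    by apply: eq_bigr => u _; exact: lip_star HL _ _.
  - move=> y; rewrite /H /h (tactlZl la_bimap) /trip (tipZr r_bimap) -/(trip _ _).
    apply: (sposZ Hq); first exact: ltW.
    have -> : trip y (tactl la (\sum_(u <- [seq p.1 | p <- s]) l u u) y) =
        \sum_(u <- [seq p.1 | p <- s]) trip y (tactl la (l u u) y).
      apply: (big_morph (fun a => trip y (tactl la a y))) => [a b|].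
        by rewrite (tactlDl la_bimap) /trip tD.
      by rewrite -(scale0r 0) (tactlZl la_bimap) scale0r /trip t0.
    by apply: (spos_sum Hq) => u; rewrite trip_lip_pos; exact: spos_star.
have WnD n y z : iter n W (y + z) = iter n W y + iter n W z.
  by elim: n => //= n ->; rewrite /W /H (tactlDr la_bimap); zmod.
have Wn0 n : iter n W 0 = 0.
  by elim: n => //= n ->; rewrite /W /H (tactl0 C la_bimap) subr0.
have WnE n y c : iter n W (tpure y c) =
    tpure (iter n (fun z => z - la h z) y) c.
  elim: n => //= n ->; rewrite /W /H (tactlE la_bimap).
  by rewrite tpureBl.
have -> : trip x (x - iter m.*2.+1 W x) - trip x x = - trip x (iter m.*2.+1 W x).
  by rewrite /trip (tipDr r_bimap) -scaleN1r (tipZr r_bimap) scaleN1r; zmod.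
rewrite (snormN qZ) {2}/x (big_morph _ (WnD _) (Wn0 _)).
rewrite {1}/x /trip.
rewrite (big_morph (fun y => tip r y _) (fun y z => tipDl r_bimap y z _)
  (tip0l r_bimap _)).
apply: le_trans (snorm_sum qD qZ _ _) _.
apply: (@le_trans _ _ (M * (d / (M + 1)))); last first.
  rewrite mulrCA ler_piMr ?(ltW d0) // ler_pdivrMr //; lra.
rewrite /M mulr_suml big_seq [leRHS]big_seq; apply: ler_sum => p ps.
rewrite (big_morph _ (tipDr r_bimap _) (tip0r r_bimap _)).
apply: le_trans (snorm_sum qD qZ _ _) _.
rewrite mulr_suml big_seq [leRHS]big_seq; apply: ler_sum => p' ps'.
rewrite WnE tE; apply: le_trans (cross_norm Hq _ _) _.
rewrite mulrAC ler_wpM2r ?(semi_ge0 NC) //.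
apply: le_trans (ip_CS NB HX _ _) _.
rewrite ler_wpM2l ?mulr_ge0 ?ipn_ge0 //.
by apply: Ht; rewrite ?map_f // -addnn -addnS leq_addr.
Qed.

Lemma trip_inner_product : inner_product q trip.
Proof.
split; [exact: tipDr|exact: tipZr|exact: trip_star|exact: trip_spos].
Qed.
Let Hr := trip_inner_product.
Local Notation n := (ipn q trip).

Let n0 := @ipn_ge0 R TB q E trip.
Let nD := ipnD Hq Hr.
Let nZ := ipnZ Hq Hr.

Lemma tlact_bounded t : exists K, forall x, n (tlact t x) <= K * n x.
Proof.
rewrite /tlact; elim/tensor_ind: t => [|s t [K HK] [L HL']|a c].
- by exists 0 => x; rewrite t0 (snorm0 nZ) mul0r.
- by exists (K + L) => x; rewrite tD mulrDl (le_trans (nD _ _)) // lerD.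
exists (nrm a * nrm c) => x.
have -> : tbil la (@smul R C) (tpure a c) x = tactl la a (tactr c x).
  elim/tensor_ind: x => [|u v eu ev|x d].
  - by rewrite tactr0 (tactl0 C la_bimap) t0.
  - by rewrite tactrDr (tactlDr la_bimap) tD eu ev.
  - by rewrite tactrE (tactlE la_bimap) tE.
apply: (@le_trans _ _ (nrm a * n (tactr c x))).
  apply: (ipn_contract Hq Hr); [exact: (tactlDl la_bimap)|exact: (tactlZl la_bimap)|..].
    exact: (tactlM la_bimap (lact_A HL)).
  by apply: (tactl_adj r_bimap la_bimap); exact: rip_lact_adj.
rewrite -mulrA ler_wpM2l ?(semi_ge0 NA) //.
apply: (ipn_contract Hq Hr); [exact: tactrDl|exact: tactrZl|exact: tactrM|].
exact: (tactr_adj r_bimap).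
Qed.

Definition induced (t : TA) : R := opn n (tlact t).

Lemma induced_semi : cstar_semi induced.
Proof.
apply: (action_semi n0 nD nZ).
- by move=> s t x; rewrite /tlact tD.
- by move=> z t x; rewrite /tlact (tbilZl la_bimap sC).
- exact: tlactM.
- by move=> z t x; rewrite /tlact (tbilZr la_bimap sC).
- exact: tlact_bounded.
move=> t K K0 HK x; apply: (ipn_adj_le Hq Hr K0 _ (HK x)).
by rewrite tlactM -tlact_adj.
Qed.

Lemma induced_ub t x : n (tlact t x) <= induced t * n x.
Proof.
apply: (opn_ub n0 nZ); last exact: tlact_bounded.
by move=> z y; rewrite /tlact (tbilZr la_bimap sC).
Qed.

Lemma tract_le x t : n (tract x t) <= n x * q t.
Proof.
apply: (ipn_le Hq); first by rewrite mulr_ge0 ?n0.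
rewrite trip_tract -[trip _ _]trip_star trip_tract starM trip_star.
rewrite exprMn (ipn_sq _ Hq) (le_trans (semiM Hq _ _)) //.
rewrite expr2 mulrA ler_wpM2r // mulrC -(semi_star Hq t); exact: (semiM Hq).
Qed.

(** The lower bound is the rank-one estimate. For the upper one, l(x,x)^(m+2) y = x r(x,x)^(m+1)
    r(x,y), and taking powers removes the 4 of [ip_CS]. *)
Lemma induced_tlip x : induced (tlip x x) = q (trip x x).
Proof.
have HI := induced_semi.
apply/eqP; rewrite eq_le; apply/andP; split; last first.
  apply: (ip_rank_one_le Hq Hr (f := tlact (tlip x x)) (act := tract)).
  - by move=> y z a; exact: trip_tract.
  - by move=> z; exact: tcompat.
  - exact: semi_ge0 HI _.
  - exact: induced_ub.
apply: (@pow_growth _ _ _ (4 * q (trip x x) ^+ 2) 0 2) => [|//|m].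
  exact: semi_ge0 HI _.
rewrite mul0r addr0 addn2 -(semi_spow HI); last exact: tlip_star.
apply: (opn_le nZ); first by rewrite !mulr_ge0 ?exprn_ge0 ?sqr_ge0.
move=> y; have -> : tlact (spow (tlip x x) m.+1) y =
    tract x (spow (trip x x) m ** trip x y).
  elim: m => [|m IH]; first by rewrite /= tlactM !tcompat trip_tract.
  by rewrite [spow _ m.+2]/= tlactM IH tcompat trip_tract smulA.
apply: le_trans (tract_le _ _) _.
apply: le_trans (ler_wpM2l (n0 _) (semiM Hq _ _)) _.
have := ip_CS Hq Hr x y => CS.
apply: le_trans (ler_wpM2l (n0 _) (ler_pM (q0 _) (q0 _) (semi_spow_le Hq _ _) CS)) _.
rewrite -(ipn_sq _ Hq) exprS.
by rewrite le_eqVlt; apply/orP; left; apply/eqP; ring.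
Qed.

(** If t acts as 0 up to [q], then all <y, t x> vanish. On pure tensors this says that the maps a ->
    <y, a x> and c -> c1^* c c2 jointly annihilate t, and both families separate points. *)
Lemma induced_eq0 : (forall s, q s = 0 -> s = 0) -> forall t, induced t = 0 -> t = 0.
Proof.
move=> qd t It.
have tr0 y x : trip y (tlact t x) = 0.
  apply: qd; apply/eqP; rewrite eq_le q0 andbT.
  apply: le_trans (ip_CS Hq Hr _ _) _.
  have := induced_ub t x; rewrite It mul0r => H.
  have -> : n (tlact t x) = 0 by apply/eqP; rewrite eq_le H n0.
  by rewrite mulr0.
rewrite (tensor_sum t).
apply: (@tensor_eq0 _ _ _ B C (X * X) (C * C) (fun p a => r p.1 (la a p.2))
   (fun p c => star p.1 ** (c ** p.2))).
- by move=> [y x]; split=> *; rewrite ?(lactDl HL) ?(ripDr HR) ?(lactZl HL) ?(ripZr HR).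
- by move=> [c d]; split=> *; rewrite ?smulDl ?smulDr ?smulZl ?smulZr.
- move=> a Ha; apply: (full_eq0 (@ib_left_full _ _ _ X)) => x y.
  suff ax z : la a z = 0 by rewrite -(lip_act HL) ax -(scale0r 0) (lipZl HL) scale0r.
  by apply: (rip_eq0 HR); exact: (Ha (la a z, z)).
(* The pair chosen below produces the square of c^*c, of norm |c|^4. *)
- move=> c Hc; apply: nrm_eq0.
  have := congr1 (@nrm R C) (Hc (c, star c ** c)).
  rewrite /= (snorm0 (semiZ NC)) !smulA -smulA (semi_sq NC); last by rewrite starM starK.
  by rewrite (semiE NC) => /eqP; rewrite !expf_eq0 /= => /eqP.
move=> [y x] [c d] /=; have := tr0 (tpure y c) (tpure x d).
rewrite {1}(tensor_sum t) /trip /tlact.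
rewrite (big_morph (fun t => tbil la (@smul R C) t _)
  (fun s t => tbilDl la_bimap sC s t _) (tbil0l la_bimap sC _)).
rewrite (big_morph _ (tipDr r_bimap _) (tip0r r_bimap _)) => E0.
by rewrite -[RHS]E0; apply: eq_bigr => p _; rewrite !tE.
Qed.

(** Products are what can be reached directly: c c' is the inner product of [star c] and c' in [C],
    while a single element would first have to be factored. *)
Lemma smul_approx s t d : 0 < d -> exists es : seq (E * E),
  q (s ** t - \sum_(p <- es) trip p.1 p.2) <= d.
Proof.
pose approx (u : TB) := forall d, 0 < d -> exists es : seq (E * E),
  q (u - \sum_(p <- es) trip p.1 p.2) <= d.
have zero : approx 0.
  by move=> e e0; exists [::]; rewrite big_nil subr0 (snorm0 qZ) ltW.
have add (u v : TB) : approx u -> approx v -> approx (u + v).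
  move=> Hu Hv e e0; have e2 : 0 < e / 2 by rewrite divr_gt0.
  have [es Hes] := Hu _ e2; have [fs Hfs] := Hv _ e2.
  exists (es ++ fs); rewrite big_cat /=.
  move: (\sum_(p <- es) _) (\sum_(p <- fs) _) Hes Hfs => S1 S2 H1 H2.
  have -> : u + v - (S1 + S2) = (u - S1) + (v - S2) by zmod.
  have := qD (u - S1) (v - S2); lra.
elim/tensor_ind: s d => [|u v eu ev|b c] d d0.
- by rewrite smul0l; exact: zero.
- by rewrite smulDl; exact: add.
elim/tensor_ind: t d d0 => [|u v eu ev|b' c'] d d0.
- by rewrite smul0r; exact: zero.
- by rewrite smulDr; exact: add.
rewrite tsmulE; have c0 := semi_ge0 NC (c ** c').
have c1 : 0 < nrm (c ** c') + 1 by lra.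
have [s Hs] := full_approx (@ib_right_full _ _ _ X) (b ** b') (divr_gt0 d0 c1).
exists [seq (tpure p.2.1 (star c), tpure (p.1 *: p.2.2) c') | p <- s].
rewrite big_map /=.
have -> : \sum_(p <- s) trip (tpure p.2.1 (star c)) (tpure (p.1 *: p.2.2) c') =
    tpure (\sum_(p <- s) p.1 *: r p.2.1 p.2.2) (c ** c').
  rewrite (big_morph (fun b => tpure b (c ** c')) (fun x y => tpureDl x y _) (tpure0l _ _)).
  by apply: eq_bigr => p _; rewrite /trip tE starK (ripZr HR).
rewrite -tpureBl.
apply: le_trans (cross_norm Hq _ _) _.
apply: (@le_trans _ _ (d / (nrm (c ** c') + 1) * nrm (c ** c'))).
  by rewrite ler_wpM2r // ltW.
rewrite -mulrA ler_piMr ?(ltW d0) // mulrC ler_pdivrMr //; lra.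
Qed.

End FromB.
End Induced.

(** * The inner squares determine the norm *)

Section Determined.
Variables (R : realType) (A B C : cstarAlgType R) (X : imprimitivity_bimodule A B).
Local Notation TB := (tensor B C).
Local Notation tr := (@trip R A B C X).
Variables q1 q2 : TB -> R.
Hypotheses (H1 : cstar_semi q1) (H2 : cstar_semi q2).
Hypothesis trq : forall x, q1 (tr x x) = q2 (tr x x).

(* q1(s^(m+3)) is estimated by replacing s^2 with an approximating sum of inner products,
   on which right multiplication by powers of s is bounded by q2. *)
Lemma trip_determines_le t : q1 t <= q2 t.
Proof.
suff sa s : star s = s -> q1 s <= q2 s.
  rewrite -(ler_pXn2r (n := 2)) ?nnegrE ?(semi_ge0 H1) ?(semi_ge0 H2) //.
  by rewrite -(semiE H1) -(semiE H2); apply: sa; rewrite starM starK.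
move=> ss; have [->|s0] := eqVneq (q1 s) 0; first exact: semi_ge0 H2 _.
have {}s0 : 0 < q1 s by rewrite lt_def s0 (semi_ge0 H1).
(* With this [d] the error term is half of [q1 s ^+ m.+3] and is absorbed by the left side. *)
pose d := q1 s ^+ 2 / 2; have d0 : 0 < d by rewrite divr_gt0 // exprn_gt0.
have [es Hes] := smul_approx X H1 s s d0.
pose n1 := ipn q1 tr; have I1 := trip_inner_product X H1.
have n_ge0 x : 0 <= n1 x := ipn_ge0 _ _ x.
have nle x m : n1 (tract x (spow s m)) <= n1 x * q2 s ^+ m.+1.
  have nE y : n1 y = ipn q2 tr y by rewrite /n1 /ipn trq.
  rewrite !nE (le_trans (tract_le H2 _ _)) // ler_wpM2l ?ipn_ge0 //.
  exact: semi_spow_le H2 _ _.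
pose K := \sum_(p <- es) 4 * n1 p.1 * n1 p.2.
have K0 : 0 <= K by apply: sumr_ge0 => p _; rewrite !mulr_ge0.
apply: (@pow_growth _ _ _ (2 * K * q2 s) 0 3) => [||m]; try exact: semi_ge0.
rewrite mul0r addr0 addn3.
set S := \sum_(p <- es) tr p.1 (tract p.2 (spow s m)).
have sE : spow s m.+2 = (s ** s - \sum_(p <- es) tr p.1 p.2) ** spow s m + S.
  have SE : (\sum_(p <- es) tr p.1 p.2) ** spow s m = S.
    by rewrite smul_suml; apply: eq_bigr => p _; rewrite trip_tract.
  by rewrite smulBl SE subrK -smulA.
have HS : q1 S <= K * q2 s ^+ m.+1.
  apply: le_trans (snorm_sum (semiD H1) (semiZ H1) _ _) _.
  rewrite /K mulr_suml; apply: ler_sum => p _.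
  apply: le_trans (ip_CS H1 I1 _ _) _.
  by rewrite -!mulrA !ler_wpM2l.
have HP : q1 ((s ** s - \sum_(p <- es) tr p.1 p.2) ** spow s m) <= d * q1 s ^+ m.+1.
  apply: le_trans (semiM H1 _ _) _.
  by rewrite ler_pM ?(semi_ge0 H1) // semi_spow_le.
have Hm : q1 s ^+ m.+3 = 2 * (d * q1 s ^+ m.+1).
  by rewrite /d !exprS; field.
have -> : 2 * K * q2 s * q2 s ^+ m = 2 * (K * q2 s ^+ m.+1) by rewrite exprS; ring.
have := semiD H1 ((s ** s - \sum_(p <- es) tr p.1 p.2) ** spow s m) S.
rewrite -sE (semi_spow H1) // Hm; lra.
Qed.

End Determined.

(** * The conjugate bimodule *)

Definition conj_module (V : Type) : Type := V.

Section ConjModule.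
Variables (R : realType) (V : lmodType R[i]).
Local Notation W := (conj_module V).

HB.instance Definition _ := GRing.Zmodule.on W.

Definition cscale (z : R[i]) (x : W) : W := (z^* *: (x : V) : V).

Lemma cscaleA z w x : cscale z (cscale w x) = cscale (z * w) x.
Proof. by rewrite /cscale scalerA rmorphM. Qed.
Lemma cscale1 : left_id 1 cscale.
Proof. by move=> x; rewrite /cscale rmorph1 scale1r. Qed.
Lemma cscaleDr : right_distributive cscale +%R.
Proof. by move=> z x y; exact: scalerDr. Qed.
Lemma cscaleDl x : {morph cscale^~ x : z w / z + w}.
Proof. by move=> z w; rewrite /cscale rmorphD; exact: scalerDl. Qed.

HB.instance Definition _ :=
  GRing.Zmodule_isLmodule.Build R[i] W cscaleA cscale1 cscaleDr cscaleDl.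

End ConjModule.

Section ConjBimodule.
Variables (R : realType) (A B : cstarAlgType R) (X : imprimitivity_bimodule A B).
Let HL := ib_left X.
Let HR := ib_right X.
Local Notation W := (conj_module X).

Definition conj_lact (b : B) (x : W) : W := ib_ract (i := X) x (star b).
Definition conj_ract (x : W) (a : A) : W := ib_lact (i := X) (star a) x.
Definition conj_lip (x y : W) : B := ib_rip (i := X) x y.
Definition conj_rip (x y : W) : A := ib_lip (i := X) x y.

Lemma conj_left : left_hilbert_module conj_lact conj_lip.
Proof.
split.
- by move=> a b x; rewrite /conj_lact starM (ract_A HR).
- by move=> a b x; rewrite /conj_lact starD (ractDr HR).
- by move=> a x y; exact: ractDl HR _ _ _.
- by move=> z a x; rewrite /conj_lact starZ (ractZr HR).
- by move=> z a x; exact: ractZl HR _ _ _.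
- by move=> x y w; exact: (ipDl (rip_inner_product X)).
- move=> z x y; rewrite /conj_lip -[z in RHS]conjCK.
  exact: (ipZl (rip_inner_product X)).
- by move=> a x y; rewrite /conj_lip rip_ractl starK.
- by move=> x y; exact: rip_star HR _ _.
- by move=> x; exact: rip_pos HR _.
- by move=> x; exact: rip_eq0 HR _.
- exact: rip_complete HR.
Qed.

Lemma conj_right : right_hilbert_module conj_ract conj_rip.
Proof.
split.
- by move=> x a b; rewrite /conj_ract starM (lact_A HL).
- by move=> x y a; exact: lactDr HL _ _ _.
- by move=> x a b; rewrite /conj_ract starD (lactDl HL).
- by move=> z x a; exact: lactZr HL _ _ _.
- by move=> z x a; rewrite /conj_ract starZ (lactZl HL).
- by move=> w x y; exact: lipDr.
- move=> z x y; rewrite /conj_rip -[z in RHS]conjCK; exact: lipZr.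
- by move=> x y a; rewrite /conj_rip lip_lactr starK.
- by move=> x y; exact: lip_star HL _ _.
- by move=> x; exact: lip_pos HL _.
- by move=> x; exact: lip_eq0 HL _.
- exact: lip_complete HL.
Qed.

Definition conj_bimodule : imprimitivity_bimodule B A.
Proof.
apply: (@Build_imprimitivity_bimodule R B A W conj_lact conj_ract conj_lip conj_rip).
- by move=> b x a; rewrite /conj_ract /conj_lact ib_bimodule.
- exact: conj_left.
- exact: conj_right.
- exact: ib_right_full.
- exact: ib_left_full.
- by move=> b; exact: ib_ract_adj.
- by move=> a; exact: ib_lact_adj.
- move=> x y z; rewrite /conj_lact /conj_lip /conj_ract /conj_rip.
  by rewrite (rip_star HR) (lip_star HL) ib_compat.
Defined.

End ConjBimodule.

(** * Transfer of nuclearity *)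

Section Nuclear.
Variables (R : realType) (A B C : cstarAlgType R).

Lemma induced_norm (X : imprimitivity_bimodule A B) (q : tensor B C -> R[i]) :
  cstar_norm q -> exists2 p : tensor A C -> R[i], cstar_norm p &
    forall x, complex.Re (p (tlip (X := X) x x)) = complex.Re (q (trip (X := X) x x)).
Proof.
move=> Hq; have Hs := cstar_norm_semi Hq.
exists (fun t => (induced X (fun s => complex.Re (q s)) t)%:C).
  apply: cstar_semi_norm; first exact: induced_semi.
  apply: (induced_eq0 Hs) => s qs0; apply: (cstar_norm_eq0 Hq).
  by rewrite (cstar_normRe _ Hq) qs0.
by move=> x /=; exact: induced_tlip.
Qed.

End Nuclear.

Lemma nuclear_imprimitivity (R : realType) (A B : cstarAlgType R)
  (X : imprimitivity_bimodule A B) : nuclear A -> nuclear B.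
Proof.
move=> nA C; have [p0 [Hp0 p0_uniq]] := nA C.
(* Existence: the norm on A (x) C is transported along the conjugate bimodule. *)
have [q Hq _] := induced_norm (conj_bimodule X) Hp0.
exists q; split=> // q' Hq'.
(* Uniqueness: both induced norms on A (x) C equal [p0], so q and q' agree on inner squares. *)
have [p Hp pE] := induced_norm X Hq; have [p' Hp' pE'] := induced_norm X Hq'.
have pp : p = p' by rewrite -(p0_uniq _ Hp) (p0_uniq _ Hp').
have HS := cstar_norm_semi Hq; have HS' := cstar_norm_semi Hq'.
apply: funext => t; rewrite (cstar_normRe t Hq) (cstar_normRe t Hq'); congr (_%:C).
apply/eqP; rewrite eq_le; apply/andP; split.
  by apply: (trip_determines_le HS HS' (X := X)) => x; rewrite -pE pp pE'.
by apply: (trip_determines_le HS' HS (X := X)) => x; rewrite -pE -pE' pp.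
Qed.

Theorem theorem15 (R : realType) (A B : cstarAlgType R)
    (X : imprimitivity_bimodule A B) :
  nuclear A <-> nuclear B.
Proof.
split; first exact: nuclear_imprimitivity X.
exact: nuclear_imprimitivity (conj_bimodule X).
Qed.
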